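(* Let $\mathcal{V}$ and $\mathcal{W}$ be varieties of algebras such that $\mathcal{W}$ has finite similarity type. Let $(X,\mathbf{X})$ be an $\aleph_0$-lifter of a poset $P$. Let $\vec A=(A_p,f_{p,q}\mid p\le q\text{ in }P)$ be a $P$-indexed diagram in $\mathcal{V}$ such that $\operatorname{Con}_{\mathrm c}A_p$ is finite for each $p\in P^{=}$. Let $B\in\mathcal{W}$ be such that $\operatorname{Con}_{\mathrm c}B\cong\operatorname{Con}_{\mathrm c}(\mathbf{F}(X)\otimes\vec A)$. Then there exists a partial lifting $\vec{\boldsymbol B}=(\boldsymbol B_p,\boldsymbol g_{p,q}\mid p\le q\text{ in }P)$ of $\operatorname{Con}_{\mathrm c}\circ\vec A$ in $\mathcal{W}$ such that $\boldsymbol B_p$ is finite for each $p\in P^{=}$ and $\boldsymbol B_p$ is a quotient of $\boldsymbol G(B)$ for each maximal element $p$ of $P$.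
   Context: **Semilattices and congruences.** A $(\vee,0)$-semilattice is a join-semilattice with least element $0$; $(\vee,0)$-homomorphisms preserve $\vee$ and $0$; a $(\vee,0)$-embedding is a one-to-one one. For a subset $X$ of a poset $S$, $S\downarrow X=\{s\in S\mid \exists x\in X,\ s\le x\}$. An ideal of a $(\vee,0)$-semilattice $S$ is a lower subset containing $0$ and closed under $\vee$; for an ideal $I$, $S/I$ is the quotient of $S$ by the congruence $\{(x,y)\mid \exists u\in I,\ x\vee u=y\vee u\}$. For an algebra $A$, $\operatorname{Con}_{\mathrm c}A$ is the $(\vee,0)$-semilattice of compact (finitely generated) congruences of $A$, $\Theta_A(x,y)$ is the smallest congruence identifying $x$ and $y$, and $\operatorname{Con}_{\mathrm c}$ is a functor: for $f\colon A\to B$, $(\operatorname{Con}_{\mathrm c}f)(\theta)$ is the congruence of $B$ generated by $\{(f(x),f(y))\mid (x,y)\in\theta\}$. $P^{=}$ is the set of non-maximal elements of $P$. **Norm-coverings and lifters.** A finite subset $V$ of a poset $U$ is a kernel if for every $u\in U$ there is a largest $v\in V$ with $v\le u$. $U$ is supported if every finite subset of $U$ is contained in a kernel. A norm-covering of $P$ is a pair $(U,\partial)$ with $U$ a supported poset and $\partial\colon U\to P$ isotone. An ideal (nonempty, upward directed, lower subset) $\boldsymbol u$ of $U$ is sharp if $\{\partial u\mid u\in\boldsymbol u\}$ has a largest element, denoted $\partial\boldsymbol u$. $\operatorname{Id_s}U$ is the set of sharp ideals ordered by inclusion. An $\aleph_0$-lifter of $P$ is a pair $(U,\mathbf U)$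 where $U$ is a norm-covering of $P$ and $\mathbf U\subseteq\operatorname{Id_s}U$ such that: (1) the set $\mathbf U^{=}=\{\boldsymbol u\in\mathbf U\mid\partial\boldsymbol u\text{ not maximal in }P\}$ satisfies that $\mathbf U\downarrow\boldsymbol u=\{\boldsymbol v\in\mathbf U\mid \boldsymbol v\subseteq\boldsymbol u\}$ is finite for each $\boldsymbol u\in\mathbf U^{=}$; (2) for every map $S\colon\mathbf U^{=}\to[U]^{<\omega}$ (finite subsets of $U$) there is an isotone $\sigma\colon P\to\mathbf U$ with $\partial\sigma(p)=p$ for all $p\in P$ and $S(\sigma(p))\cap\sigma(q)\subseteq\sigma(p)$ for all $p<q$ in $P$. **Condensate.** For a norm-covering $(X,\partial)$ of $P$ and a $P$-indexed diagram $\vec A=(A_p,f_{p,q})$ in a variety, $\mathbf F(X)\otimes\vec A$ is the directed colimit, over all kernels $V$ of $X$ ordered by inclusion, of the finite products $\prod_{v\in V}A_{\partial v}$, with transition map for kernels $V\subseteq W$ sending $(a_v)_{v\in V}$ to $(f_{\partial(w^V),\partial w}(a_{w^V}))_{w\in W}$, where $w^V$ is the largest element of $V$ below $w$. **Partial algebras.** Fix a similarity type $\mathscr L$; $\operatorname{ar}(\ell)$ is the arity of $\ell\in\mathscr L$. A partial algebra $A$ is a set with, for each $\ell\in\mathscr L$, a set $\operatorname{Def}_\ell(A)\subseteq A^{\operatorname{ar}(\ell)}$ and a map $\ell^A\colon\operatorname{Def}_\ell(A)\to A$. Definedness of terms is obtained by induction (all subterms must be defined). An algebra is a partial algebra with $\operatorname{Def}_\ell(A)=A^{\operatorname{ar}(\ell)}$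 for all $\ell$. A morphism $f\colon A\to B$ satisfies $f(\vec x)\in\operatorname{Def}_\ell(B)$ and $\ell(f(\vec x))=f(\ell(\vec x))$ for all $\vec x\in\operatorname{Def}_\ell(A)$. A partial subalgebra $B$ of $A$ is a subset with a partial algebra structure such that $\operatorname{Def}_\ell(B)\subseteq\operatorname{Def}_\ell(A)$ and $\ell^B=\ell^A$ on $\operatorname{Def}_\ell(B)$; it is strong if $B^{\operatorname{ar}(\ell)}\subseteq\operatorname{Def}_\ell(A)$ for all $\ell$. The image $f(X)$ of a partial subalgebra $X$ carries the structure $\operatorname{Def}_\ell(f(X))=f(\operatorname{Def}_\ell(X))$. A partial algebra satisfies an identity $t_1=t_2$ if $t_1(\vec x)=t_2(\vec x)$ whenever both sides are defined. **Pregamps.** A pregamp is $(A,\delta_{\boldsymbol A},\widetilde A)$ with $A$ a partial algebra, $\widetilde A$ a $(\vee,0)$-semilattice, $\delta=\delta_{\boldsymbol A}\colon A^2\to\widetilde A$ with $\delta(x,y)=0\iff x=y$, $\delta(x,y)=\delta(y,x)$, $\delta(x,y)\le\delta(x,z)\vee\delta(z,y)$, and $\delta(\ell(\vec x),\ell(\vec y))\le\bigvee_{k<\operatorname{ar}(\ell)}\delta(x_k,y_k)$ for $\vec x,\vec y\in\operatorname{Def}_\ell(A)$. A morphism $\boldsymbol f=(f,\widetilde f)$ of pregamps consists of a morphism $f\colon A\to B$ of partial algebras and a $(\vee,0)$-homomorphism $\widetilde f\colon\widetilde A\to\widetilde B$ with $\delta_{\boldsymbol B}(f(x),f(y))=\widetilde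 f(\delta_{\boldsymbol A}(x,y))$. For an ideal $I$ of $\widetilde A$, $A/I$ is the set of classes $x/I$ of the equivalence $\delta_{\boldsymbol A}(x,y)\in I$, with $\operatorname{Def}_\ell(A/I)=\{\vec x/I\mid\vec x\in\operatorname{Def}_\ell(A)\}$, $\ell(\vec x/I)=\ell(\vec x)/I$, and $\delta_{\boldsymbol A/I}(x/I,y/I)=\delta_{\boldsymbol A}(x,y)/I\in\widetilde A/I$. A pregamp is a pregamp of a variety $\mathcal V$ if $A/I$ satisfies all identities of $\mathcal V$ for every ideal $I$ of $\widetilde A$. **Gamps.** A gamp of $\mathcal V$ is $\boldsymbol A=(A^*,A,\delta_{\boldsymbol A},\widetilde A)$ with $(A,\delta_{\boldsymbol A},\widetilde A)$ a pregamp of $\mathcal V$ and $A^*$ a partial subalgebra of $A$. It is finite if $A$ and $\widetilde A$ are finite. A morphism of gamps $\boldsymbol A\to\boldsymbol B$ is a morphism of the underlying pregamps such that $f(A^* )$ is a partial subalgebra of $B^*$. For an ideal $I$ of $\widetilde A$, the quotient is $\boldsymbol A/I=(A^*/I,A/I,\delta_{\boldsymbol A/I},\widetilde A/I)$, where $A^*/I=\{a/I\mid a\in A^*\}$ is the image of $A^*$. For an algebra $B$, $\boldsymbol G(B)=(B,B,\Theta_B,\operatorname{Con}_{\mathrm c}B)$. The functor $\boldsymbol C$ sends $\boldsymbol A$ to $\widetilde A$ and $\boldsymbol f$ to $\widetilde f$. A realization of a gamp $\boldsymbol A$ of $\mathcal V$ is $(A',\chi)$ with $A'\in\mathcal V$,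 $A$ a partial subalgebra of $A'$, $\chi\colon\widetilde A\to\operatorname{Con}_{\mathrm c}A'$ a $(\vee,0)$-embedding and $\chi(\delta_{\boldsymbol A}(x,y))=\Theta_{A'}(x,y)$ for $x,y\in A$; it is isomorphic if $\chi$ is an isomorphism. A gamp $\boldsymbol A$ is: strong if $A^*$ is a strong partial subalgebra of $A$; distance-generated if every element of $\widetilde A$ is a finite join of elements $\delta_{\boldsymbol A}(x,y)$, $x,y\in A^*$; congruence-tractable if whenever $x,y,x_0,y_0,\dots,x_{m-1},y_{m-1}\in A^*$ and $\delta_{\boldsymbol A}(x,y)\le\bigvee_{k<m}\delta_{\boldsymbol A}(x_k,y_k)$, there are a positive integer $n$, a list $\vec z$ from $A$ and terms $t_0,\dots,t_n$ such that, with everything defined in $A$, $x=t_0(\vec x,\vec y,\vec z)$, $y=t_n(\vec x,\vec y,\vec z)$, $t_k(\vec y,\vec x,\vec z)=t_{k+1}(\vec x,\vec y,\vec z)$ for all $k<n$. A morphism $\boldsymbol f\colon\boldsymbol A\to\boldsymbol B$ of gamps is: strong if $f(A)$ is a strong partial subalgebra of $B^*$; congruence-cuttable if $f(A)$ is a partial subalgebra of $B^*$ and for each finite $X\subseteq\widetilde B$ and $x,y\in A$ with $\delta_{\boldsymbol B}(f(x),f(y))\le\bigvee X$ there are $n<\omega$ and $f(x)=x_0,\dots,x_n=f(y)$ in $B^*$ with $\delta_{\boldsymbol B}(x_k,x_{k+1})\in\widetilde B\downarrow X$ for all $k<n$. **Partial lifting.** A partial lifting in $\mathcal V$ is a $P$-indexed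 diagram $(\boldsymbol A_p,\boldsymbol f_{p,q})$ of gamps of $\mathcal V$ such that each $\boldsymbol A_p$ is strong, congruence-tractable, distance-generated and has an isomorphic realization, and $\boldsymbol f_{p,q}$ is strong and congruence-cuttable for all $p<q$. It is a partial lifting of a diagram $\vec S$ of $(\vee,0)$-semilattices if $\boldsymbol C\circ\vec{\boldsymbol A}\cong\vec S$ (natural isomorphism).
   Formalization: All algebras (the A_p, B, and the members of the varieties) are assumed nonempty; with an empty A_p the condensate can be empty and the claim fails, e.g. P={0<1}, A_0 empty, A_1 the two-element lattice, B one-element. *)

(* Defs.v *)
From HB Require Import structures.
From mathcomp Require Import all_boot all_order.
From mathcomp Require Import boolp classical_sets cardinality.
From Corelib Require Import RelationClasses.

Set Implicit Arguments.
Unset Strict Implicit.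
Unset Printing Implicit Defensive.

Import Order.TTheory.

Local Open Scope classical_set_scope.
Local Open Scope order_scope.

Definition quot (T : Type) (R : T -> T -> Prop) : Type :=
  {c : T -> Prop | exists x, c = R x}.

Definition cls (T : Type) (R : T -> T -> Prop) (x : T) : quot R :=
  exist _ (R x) (ex_intro _ x erefl).

Lemma cls_surj T (R : T -> T -> Prop) (c : quot R) : exists x, c = cls R x.
Proof.
case: c => c [x cE]; exists x; apply: eq_exist => //=.
Qed.

Definition repr T (R : T -> T -> Prop) (c : quot R) : T := projT1 (cid (cls_surj c)).

Lemma reprK T (R : T -> T -> Prop) (c : quot R) : cls R (repr c) = c.
Proof. by rewrite /repr; case: cid. Qed.

Lemma cls_eq T (R : T -> T -> Prop) (eR : Equivalence R) x y :
  cls R x = cls R y <-> R x y.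
Proof.
split=> [/(congr1 (@proj1_sig _ _)) /= ->|Rxy].
  exact: Equivalence_Reflexive.
apply: eq_exist => /=; apply/funext => z; apply/propext; split=> h.
  by apply: Equivalence_Transitive h; apply: Equivalence_Symmetric.
exact: Equivalence_Transitive Rxy h.
Qed.

Lemma repr_cls T (R : T -> T -> Prop) (eR : Equivalence R) x : R (repr (cls R x)) x.
Proof. by apply/(cls_eq eR); rewrite reprK. Qed.

Fact semi_display : Order.disp_t. Proof. exact: Order.Disp tt tt. Qed.

Notation semilattice := (bJoinSemilatticeType semi_display).

Definition is_semihom (S T : semilattice) (f : S -> T) : Prop :=
  f \bot = \bot /\ {morph f : x y / x `|` y}.

Definition semi_isomorphic (S T : semilattice) : Prop :=
  exists f : S -> T, is_semihom f /\ bijective f.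

Record ideal (S : semilattice) := Ideal {
  ideal_set :> S -> Prop;
  ideal0 : ideal_set \bot;
  ideal_lower : forall x y, x <= y -> ideal_set y -> ideal_set x;
  idealU : forall x y, ideal_set x -> ideal_set y -> ideal_set (x `|` y) }.

Definition ideal_rel (S : semilattice) (I : ideal S) (x y : S) : Prop :=
  exists2 u, I u & x `|` u = y `|` u.

Lemma ideal_rel_equiv (S : semilattice) (I : ideal S) : Equivalence (ideal_rel I).
Proof.
split.
- by move=> x; exists \bot => //; apply: ideal0.
- by move=> x y [u Iu e]; exists u.
- move=> x y z [u Iu e] [v Iv e']; exists (u `|` v); first exact: idealU.
  by rewrite joinA e joinAC e' joinAC joinA.
Qed.

Definition semi_quot (S : semilattice) (I : ideal S) : Type := quot (ideal_rel I).

Section SemiQuot.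
Variables (S : semilattice) (I : ideal S).

Definition semi_pi (x : S) : semi_quot I := cls (ideal_rel I) x.

Definition quot_join (X Y : semi_quot I) : semi_quot I := semi_pi (repr X `|` repr Y).

Lemma semi_pi_eq x y : semi_pi x = semi_pi y <-> ideal_rel I x y.
Proof. exact: (cls_eq (ideal_rel_equiv I) x y). Qed.

Lemma semi_pi_surj X : exists x, X = semi_pi x.
Proof. exact: cls_surj. Qed.

Lemma quot_joinE x y : quot_join (semi_pi x) (semi_pi y) = semi_pi (x `|` y).
Proof.
apply/semi_pi_eq.
have [u Iu e] := repr_cls (ideal_rel_equiv I) x.
have [v Iv e'] := repr_cls (ideal_rel_equiv I) y.
exists (u `|` v); first exact: idealU.
by rewrite joinACA e e' joinACA.
Qed.

Lemma quot_joinC : commutative quot_join.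
Proof.
move=> X Y; have [x ->] := semi_pi_surj X; have [y ->] := semi_pi_surj Y.
by rewrite !quot_joinE joinC.
Qed.

Lemma quot_joinA : associative quot_join.
Proof.
move=> X Y Z; have [x ->] := semi_pi_surj X; have [y ->] := semi_pi_surj Y.
by have [z ->] := semi_pi_surj Z; rewrite !quot_joinE joinA.
Qed.

Lemma quot_joinxx X : quot_join X X = X.
Proof. by have [x ->] := semi_pi_surj X; rewrite quot_joinE joinxx. Qed.

HB.instance Definition _ := gen_eqMixin (semi_quot I).
HB.instance Definition _ := gen_choiceMixin (semi_quot I).

Definition quot_le (X Y : semi_quot I) : bool := quot_join Y X == Y.

Lemma quot_le_refl : reflexive quot_le.
Proof. by move=> X; apply/eqP/quot_joinxx. Qed.

Lemma quot_le_anti : antisymmetric quot_le.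
Proof. by move=> X Y /andP[/eqP e /eqP e']; rewrite -e' quot_joinC. Qed.

Lemma quot_le_trans : transitive quot_le.
Proof. by move=> Y X Z /eqP e /eqP e'; apply/eqP; rewrite -e' -quot_joinA e. Qed.

HB.instance Definition _ := Order.Le_isPOrder.Build semi_display (semi_quot I)
  quot_le_refl quot_le_anti quot_le_trans.

HB.instance Definition _ := Order.POrder_Join_isSemilattice.Build semi_display
  (semi_quot I) quot_joinC quot_joinA (fun x y => erefl).

Lemma quot_le0 X : semi_pi \bot <= X.
Proof.
have [x ->] := semi_pi_surj X; apply/eqP.
by rewrite quot_joinE joinx0.
Qed.

HB.instance Definition _ := Order.hasBottom.Build semi_display (semi_quot I) quot_le0.

Lemma semi_pi_hom : is_semihom (semi_pi : S -> semi_quot I).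
Proof. by split=> // x y; rewrite -quot_joinE. Qed.

Lemma semi_pi_le x y : semi_pi x <= semi_pi y <-> exists2 u, I u & x <= y `|` u.
Proof.
split=> [/eqP|[u Iu h]].
  rewrite quot_joinE => /semi_pi_eq[u Iu e]; exists u => //.
  by rewrite -e joinAC lexU2 // lexx orbT.
apply/eqP; rewrite quot_joinE; apply/semi_pi_eq; exists u => //.
by rewrite joinAC; apply/join_idPl.
Qed.

Lemma semi_pi_eq0 x : semi_pi x = \bot <-> I x.
Proof.
split=> [/semi_pi_eq[u Iu e]|Ix].
  by apply: ideal_lower Iu; rewrite join0x in e; rewrite -e leUl.
by apply/semi_pi_eq; exists x => //; rewrite joinxx join0x.
Qed.

End SemiQuot.

Record semi_diagram (d : Order.disp_t) (P : porderType d) := SemiDiagram {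
  sd_ob :> P -> semilattice;
  sd_mor : forall p q, p <= q -> sd_ob p -> sd_ob q;
  sd_hom : forall p q (pq : p <= q), is_semihom (sd_mor pq);
  sd_id : forall p (pp : p <= p) x, sd_mor pp x = x;
  sd_comp : forall p q r (pq : p <= q) (qr : q <= r) (pr : p <= r) x,
    sd_mor pr x = sd_mor qr (sd_mor pq x) }.

Definition semi_diagram_iso (d : Order.disp_t) (P : porderType d)
    (S T : semi_diagram P) : Prop :=
  exists h : forall p, S p -> T p,
    (forall p, is_semihom (h p) /\ bijective (h p)) /\
    (forall p q (pq : p <= q) x, h q (sd_mor pq x) = sd_mor pq (h p x)).

Record signature := Signature {
  symbol : Type;
  arity : symbol -> nat }.

(* [pa_graph l x y] means that [x] is in Def_l and that [l] maps [x] to [y]. *)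
Record partial_algebra (L : signature) := PartialAlgebra {
  pa_carrier :> Type;
  pa_graph : forall l : symbol L, ('I_(arity l) -> pa_carrier) -> pa_carrier -> Prop;
  pa_functional : forall l (x : 'I_(arity l) -> pa_carrier) y z,
    pa_graph x y -> pa_graph x z -> y = z }.

Arguments pa_graph {L} _ l _ _.

Definition pa_def (L : signature) (A : partial_algebra L) (l : symbol L)
    (x : 'I_(arity l) -> A) : Prop :=
  exists y, pa_graph A l x y.

Record pa_hom (L : signature) (A B : partial_algebra L) := PaHom {
  pa_fun :> A -> B;
  pa_homP : forall l x y, pa_graph A l x y -> pa_graph B l (pa_fun \o x) (pa_fun y) }.

(* Algebras are nonempty, as usual in universal algebra; with the empty algebra
   among the factors a condensate could be empty, and would then forget the
   congruences of the other factors. *)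
Record algebra (L : signature) := Algebra {
  alg_pa :> partial_algebra L;
  alg_total : forall l (x : 'I_(arity l) -> alg_pa), pa_def x;
  alg_inhabited : inhabited alg_pa }.

Inductive term (L : signature) (X : Type) : Type :=
| Var of X
| App (l : symbol L) of ('I_(arity l) -> term L X).

Arguments Var {L X} _.
Arguments App {L X} l _.

(* [term_val v t a] means that [t] is defined at [v], with value [a]; this
   requires all subterms of [t] to be defined at [v]. *)
Fixpoint term_val (L : signature) (A : partial_algebra L) (X : Type) (v : X -> A)
    (t : term L X) : A -> Prop :=
  match t with
  | Var x => fun a => a = v x
  | App l ts => fun a =>
      exists b, (forall i, term_val v (ts i) (b i)) /\ pa_graph A l b a
  end.

Definition identity (L : signature) : Type := (term L nat * term L nat)%type.

Definition satisfies (L : signature) (A : partial_algebra L) (e : identity L) : Prop :=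
  forall (v : nat -> A) a b, term_val v e.1 a -> term_val v e.2 b -> a = b.

Definition is_variety (L : signature) (V : algebra L -> Prop) : Prop :=
  exists E : identity L -> Prop,
    forall A : algebra L, V A <-> (forall e, E e -> satisfies A e).

(* The identities of V are all those valid in V: a partial algebra may satisfy a
   set of identities without satisfying its consequences. *)
Definition identity_of (L : signature) (V : algebra L -> Prop) (e : identity L) : Prop :=
  forall A, V A -> satisfies A e.

Record alg_diagram (L : signature) (d : Order.disp_t) (P : porderType d) := AlgDiagram {
  ad_ob :> P -> algebra L;
  ad_mor : forall p q, p <= q -> pa_hom (ad_ob p) (ad_ob q);
  ad_id : forall p (pp : p <= p) x, ad_mor pp x = x;
  ad_comp : forall p q r (pq : p <= q) (qr : q <= r) (pr : p <= r) x,
    ad_mor pr x = ad_mor qr (ad_mor pq x) }.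

Section Congruences.
Variables (L : signature) (A : algebra L).

Record is_congruence (th : set (A * A)) : Prop := IsCongruence {
  cong_refl : forall x, th (x, x);
  cong_sym : forall x y, th (x, y) -> th (y, x);
  cong_trans : forall x y z, th (x, y) -> th (y, z) -> th (x, z);
  cong_op : forall l x y a b, (forall i, th (x i, y i)) ->
    pa_graph A l x a -> pa_graph A l y b -> th (a, b) }.

Definition cgen (X : set (A * A)) : set (A * A) := smallest is_congruence X.

Lemma cgen_cong X : is_congruence (cgen X).
Proof.
split.
- by move=> x th [thc _]; apply: cong_refl.
- by move=> x y h th hth; apply: cong_sym (h th hth); case: hth.
- move=> x y z h h' th hth; apply: cong_trans (h th hth) (h' th hth); by case: hth.
- move=> l x y a b h xa yb th hth; apply: cong_op xa yb; first by case: hth.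
  by move=> i; apply: h.
Qed.

Lemma sub_cgen X : X `<=` cgen X.
Proof. exact: sub_smallest. Qed.

Lemma cgen_sub X th : is_congruence th -> X `<=` th -> cgen X `<=` th.
Proof. by move=> thc Xth z; apply. Qed.

Lemma cgen_cgenU X Y : cgen (cgen X `|` cgen Y)%classic = cgen (X `|` Y)%classic.
Proof.
apply/seteqP; split; apply: cgen_sub; try exact: cgen_cong.
  move=> z [] h; move: z h; apply: cgen_sub; try exact: cgen_cong.
    by move=> z Xz; apply: sub_cgen; left.
  by move=> z Xz; apply: sub_cgen; right.
by move=> z [] h; apply: sub_cgen; [left|right]; apply: sub_cgen.
Qed.

Record conc := Conc {
  conc_set :> set (A * A);
  conc_fg : exists2 X, finite_set X & conc_set = cgen X }.

Lemma conc_inj (th ps : conc) : conc_set th = conc_set ps -> th = ps.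
Proof.
case: th ps => [th hth] [ps hps] /= e; subst ps; congr Conc; exact: Prop_irrelevance.
Qed.

Lemma conc_cong (th : conc) : is_congruence th.
Proof. by have [X _ ->] := conc_fg th; apply: cgen_cong. Qed.

Lemma conc_join_fg (th ps : conc) :
  exists2 X, finite_set X & cgen (th `|` ps)%classic = cgen X.
Proof.
have [X fX ->] := conc_fg th; have [Y fY ->] := conc_fg ps; exists (X `|` Y)%classic.
  by rewrite finite_setU.
exact: cgen_cgenU.
Qed.

Definition conc_join (th ps : conc) : conc := Conc (conc_join_fg th ps).

Lemma conc0_fg : exists2 X, finite_set X & cgen set0 = cgen X.
Proof. by exists set0. Qed.

Definition conc0 : conc := Conc conc0_fg.

Lemma Theta_fg x y : exists2 X, finite_set X & cgen [set (x, y)] = cgen X.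
Proof. by exists [set (x, y)] => //; apply: finite_set1. Qed.

Definition Theta x y : conc := Conc (Theta_fg x y).

HB.instance Definition _ := gen_eqMixin conc.
HB.instance Definition _ := gen_choiceMixin conc.

Definition conc_le (th ps : conc) : bool := `[< conc_set th `<=` conc_set ps >].

Lemma conc_le_refl : reflexive conc_le.
Proof. by move=> th; apply/asboolP. Qed.

Lemma conc_le_anti : antisymmetric conc_le.
Proof.
by move=> th ps /andP[/asboolP h /asboolP h']; apply/conc_inj/seteqP.
Qed.

Lemma conc_le_trans : transitive conc_le.
Proof.
by move=> ps th ch /asboolP h /asboolP h'; apply/asboolP; apply: subset_trans h h'.
Qed.

HB.instance Definition _ := Order.Le_isPOrder.Build semi_display conc
  conc_le_refl conc_le_anti conc_le_trans.

Lemma conc_leP (th ps : conc) : th <= ps <-> conc_set th `<=` conc_set ps.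
Proof. by split=> [/asboolP|h] //; apply/asboolP. Qed.

Lemma conc_leUx (th ps ch : conc) :
  (conc_join th ps <= ch) = (th <= ch) && (ps <= ch).
Proof.
apply/idP/andP => [/conc_leP h|[/conc_leP h /conc_leP h']].
  by split; apply/conc_leP => z hz; apply: h; apply: sub_cgen; [left|right].
apply/conc_leP; apply: cgen_sub; first exact: conc_cong.
by move=> z []; [apply: h|apply: h'].
Qed.

HB.instance Definition _ := Order.POrder_isJoinSemilattice.Build semi_display conc
  conc_leUx.

Lemma conc_le0 (th : conc) : conc0 <= th.
Proof. by apply/conc_leP; apply: cgen_sub => //; apply: conc_cong. Qed.

HB.instance Definition _ := Order.hasBottom.Build semi_display conc conc_le0.

Lemma Theta_le x y (th : conc) : Theta x y <= th <-> conc_set th (x, y).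
Proof.
split=> [/conc_leP h|h]; first by apply: h; apply: sub_cgen.
by apply/conc_leP; apply: cgen_sub; [exact: conc_cong | move=> _ ->].
Qed.

Lemma conc0P x y : conc_set (\bot : conc) (x, y) <-> x = y.
Proof.
split=> [h|->]; last exact: (cong_refl (conc_cong _)).
apply: (h [set z | z.1 = z.2]); split=> //; split=> //=.
- by move=> a b c -> ->.
- move=> l u v a b uv ua vb; apply: pa_functional ua _.
  by have -> : u = v by apply/funext.
Qed.

Lemma Theta0 x y : Theta x y = \bot <-> x = y.
Proof.
rewrite -conc0P -Theta_le; split=> [->|] //.
by rewrite lex0 => /eqP.
Qed.

Lemma Theta_sym x y : Theta x y = Theta y x.
Proof.
by apply/eqP; rewrite eq_le; apply/andP; split; apply/Theta_le;
  apply: (cong_sym (conc_cong _)); apply/Theta_le.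
Qed.

Lemma Theta_tri x y z : Theta x y <= Theta x z `|` Theta z y.
Proof.
apply/Theta_le; apply: (cong_trans (conc_cong _) (y := z)); apply/Theta_le.
  exact: leUl.
exact: leUr.
Qed.

Lemma Theta_op l (x y : 'I_(arity l) -> A) a b :
  pa_graph A l x a -> pa_graph A l y b ->
  Theta a b <= \join_(k < arity l) Theta (x k) (y k).
Proof.
move=> xa yb; apply/Theta_le; apply: (cong_op (conc_cong _)) xa yb => i.
apply: (proj1 (Theta_le _ _ _)).
exact: (@joins_sup _ conc _ i xpredT (fun k => Theta (x k) (y k))).
Qed.

End Congruences.

Section ConcMap.
Variable L : signature.

Definition pair_image (A B : algebra L) (f : A -> B) (X : set (A * A)) : set (B * B) :=
  [set (f z.1, f z.2) | z in X].

Lemma conc_map_gen (A B : algebra L) (f : pa_hom A B) X :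
  cgen (pair_image f (cgen X)) = cgen (pair_image f X).
Proof.
apply/seteqP; split; apply: cgen_sub; try exact: cgen_cong; last first.
  by move=> _ [z Xz <-]; apply: sub_cgen; exists z => //; apply: sub_cgen.
move=> _ [z Xz <-].
suff: cgen X `<=` [set z | cgen (pair_image f X) (f z.1, f z.2)] by apply.
have c := cgen_cong (pair_image f X).
apply: cgen_sub => [|u Xu]; last by apply: sub_cgen; exists u.
split=> [x|x y|x y t|l x y a b h xa yb] /=.
- exact: cong_refl.
- exact: cong_sym.
- exact: cong_trans.
- by apply: (cong_op c) (pa_homP f xa) (pa_homP f yb) => i; apply: h.
Qed.

Lemma conc_map_fg (A B : algebra L) (f : pa_hom A B) (th : conc A) :
  exists2 X, finite_set X & cgen (pair_image f th) = cgen X.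
Proof.
have [X fX ->] := conc_fg th; exists (pair_image f X); last exact: conc_map_gen.
exact: finite_image.
Qed.

Definition conc_map (A B : algebra L) (f : pa_hom A B) (th : conc A) : conc B :=
  Conc (conc_map_fg f th).

Lemma conc_map_hom (A B : algebra L) (f : pa_hom A B) : is_semihom (conc_map f).
Proof.
split.
  apply: conc_inj; rewrite /= conc_map_gen /pair_image image_set0 //.
move=> th ps; apply: conc_inj => /=.
by rewrite conc_map_gen cgen_cgenU /pair_image image_setU.
Qed.

Lemma conc_map_Theta (A B : algebra L) (f : pa_hom A B) x y :
  conc_map f (Theta x y) = Theta (f x) (f y).
Proof. by apply: conc_inj; rewrite /= conc_map_gen /pair_image image_set1. Qed.

Lemma conc_map_id (A : algebra L) (f : pa_hom A A) : (forall x, f x = x) ->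
  forall th, conc_map f th = th.
Proof.
move=> fE th; apply: conc_inj => /=; have [X fX ->] := conc_fg th.
rewrite conc_map_gen.
congr cgen; apply/seteqP; split=> [_ [[x y] Xz <-]|[x y] Xz] /=.
  by rewrite !fE.
by exists (x, y) => //=; rewrite !fE.
Qed.

Lemma conc_map_comp (A B C : algebra L) (f : pa_hom A B) (g : pa_hom B C)
    (h : pa_hom A C) : (forall x, h x = g (f x)) ->
  forall th, conc_map h th = conc_map g (conc_map f th).
Proof.
move=> hE th; apply: conc_inj => /=; have [X fX ->] := conc_fg th.
rewrite (conc_map_gen f) (conc_map_gen g) (conc_map_gen h).
congr cgen; rewrite /pair_image image_comp.
apply: (congr1 (fun F => F @` X)); apply/funext => z /=.
by rewrite !hE.
Qed.

Definition conc_diagram (d : Order.disp_t) (P : porderType d) (A : alg_diagram L P) :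
    semi_diagram P :=
  @SemiDiagram d P (fun p => conc (A p)) (fun p q pq => conc_map (ad_mor A pq))
    (fun p q pq => conc_map_hom (ad_mor A pq))
    (fun p pp => conc_map_id (ad_id pp))
    (fun p q r pq qr pr => conc_map_comp (ad_comp pq qr pr)).

End ConcMap.

Section Products.
Variables (L : signature) (I : Type) (A : I -> algebra L).

Definition prod_graph (l : symbol L) (x : 'I_(arity l) -> forall i, A i)
    (y : forall i, A i) : Prop :=
  forall i, pa_graph (A i) l (fun k => x k i) (y i).

Lemma prod_functional l (x : 'I_(arity l) -> forall i, A i) y z :
  prod_graph x y -> prod_graph x z -> y = z.
Proof.
move=> xy xz; apply: functional_extensionality_dep => i.
exact: pa_functional (xy i) (xz i).
Qed.

Definition prod_pa : partial_algebra L := PartialAlgebra prod_functional.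

Lemma prod_total l (x : 'I_(arity l) -> prod_pa) : pa_def x.
Proof.
exists (fun i => projT1 (cid (alg_total (fun k => x k i)))) => i.
by case: cid.
Qed.

Lemma prod_inhabited : inhabited prod_pa.
Proof.
have h i : exists x : A i, True by case: (alg_inhabited (A i)) => x; exists x.
exact: (inhabits (fun i => projT1 (cid (h i)))).
Qed.

Definition prod_alg : algebra L := Algebra prod_total prod_inhabited.

End Products.

Definition directed (d : Order.disp_t) (K : porderType d) : Prop :=
  inhabited K /\ forall i j : K, exists k, i <= k /\ j <= k.

Lemma directed_ub (d : Order.disp_t) (K : porderType d) (dK : directed K) n
  (k : 'I_n -> K) : exists m, forall i, k i <= m.
Proof.
have [[k0] ub] := dK.
suff h (s : seq 'I_n) : exists m, forall i, i \in s -> k i <= m.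
  by have [m hm] := h (enum 'I_n); exists m => i; apply: hm; rewrite mem_enum.
elim: s => [|j s [m hm]]; first by exists k0.
have [m' [h1 h2]] := ub (k j) m; exists m' => i; rewrite inE => /orP[/eqP->//|/hm h].
exact: le_trans h h2.
Qed.

Section DirectedColimit.
Variables (L : signature) (d : Order.disp_t) (K : porderType d).
Variables (D : alg_diagram L K) (dK : directed K).

Definition dcolim_rel (x y : {k : K & D k}) : Prop :=
  exists k (h : tag x <= k) (h' : tag y <= k),
    ad_mor D h (tagged x) = ad_mor D h' (tagged y).

Lemma ad_mor_irr i j (h h' : i <= j) : ad_mor D h = ad_mor D h'.
Proof. by rewrite (bool_irrelevance h h'). Qed.

Lemma dcolim_equiv : Equivalence dcolim_rel.
Proof.
split.
- by move=> x; exists (tag x), (lexx _), (lexx _).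
- by move=> x y [k [h [h' e]]]; exists k, h', h.
- move=> x y z [k [h [h' e]]] [m [g [g' e']]].
  have [n [kn mn]] := dK.2 k m.
  exists n, (le_trans h kn), (le_trans g' mn).
  rewrite (ad_comp h kn) (ad_comp g' mn) e -e' -(ad_comp h' kn (le_trans h' kn)).
  by rewrite -(ad_comp g mn (le_trans h' kn)).
Qed.

Definition dcolim_in (k : K) (x : D k) : quot dcolim_rel :=
  cls dcolim_rel (Tagged (fun k => D k : Type) x).

Lemma dcolim_in_surj X : exists k (x : D k), X = dcolim_in x.
Proof. by have [[k x] ->] := cls_surj X; exists k, x. Qed.

Lemma dcolim_in_eq k k' (x : D k) (y : D k') : dcolim_in x = dcolim_in y <->
  exists m (h : k <= m) (h' : k' <= m), ad_mor D h x = ad_mor D h' y.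
Proof. exact: (cls_eq dcolim_equiv). Qed.

Lemma dcolim_in_mor k m (h : k <= m) (x : D k) : dcolim_in (ad_mor D h x) = dcolim_in x.
Proof. by apply/dcolim_in_eq; exists m, (lexx m), h; rewrite ad_id. Qed.

Definition dcolim_graph (l : symbol L) (X : 'I_(arity l) -> quot dcolim_rel)
    (Y : quot dcolim_rel) : Prop :=
  exists k (x : 'I_(arity l) -> D k) y,
    [/\ pa_graph (D k) l x y, X = (fun i => dcolim_in (x i)) & Y = dcolim_in y].

Lemma dcolim_functional l (X : 'I_(arity l) -> quot dcolim_rel) Y Z :
  dcolim_graph X Y -> dcolim_graph X Z -> Y = Z.
Proof.
move=> [k [x [y [xy -> ->]]]] [k' [x' [y' [xy' e ->]]]].
have e' i : exists m, exists (h : k <= m) (h' : k' <= m),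
    ad_mor D h (x i) = ad_mor D h' (x' i).
  by apply/dcolim_in_eq; apply: (congr1 (fun f => f i) e).
have [m hm] := directed_ub dK (fun i => projT1 (cid (e' i))).
have [n0 [h0 h0']] := dK.2 k k'.
have [n [mn n0n]] := dK.2 m n0.
have kn := le_trans h0 n0n; have k'n := le_trans h0' n0n.
apply/dcolim_in_eq; exists n, kn, k'n.
apply: pa_functional (pa_homP (ad_mor D kn) xy) _.
rewrite (_ : _ \o x = ad_mor D k'n \o x'); first exact: pa_homP.
apply/funext => i /=.
move: (hm i); case: cid => j /= [h [h' ej]] jm.
have jn := le_trans jm mn.
by rewrite (ad_comp h jn) ej -(ad_comp h' jn k'n).
Qed.

Definition dcolim_pa : partial_algebra L := PartialAlgebra dcolim_functional.

Lemma dcolim_total l (X : 'I_(arity l) -> dcolim_pa) : pa_def X.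
Proof.
have [k hk] := directed_ub dK (fun i => tag (repr (X i))).
pose x i : D k := ad_mor D (hk i) (tagged (repr (X i))).
have [y xy] := alg_total x.
exists (dcolim_in y), k, x, y; split=> //; apply/funext => i.
rewrite /x dcolim_in_mor -[LHS]reprK; congr cls.
by case: (repr (X i)).
Qed.

Lemma dcolim_inhabited : inhabited dcolim_pa.
Proof.
have [[k] _] := dK; case: (alg_inhabited (D k)) => x.
exact: inhabits (dcolim_in x).
Qed.

Definition dcolim : algebra L := Algebra dcolim_total dcolim_inhabited.

Lemma dcolim_in_hom k l x y : pa_graph (D k) l x y ->
  pa_graph dcolim l (@dcolim_in k \o x) (dcolim_in y).
Proof. by move=> xy; exists k, x, y. Qed.

Definition dcolim_inj k : pa_hom (D k) dcolim := PaHom (@dcolim_in_hom k).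

Lemma dcolim_universal (C : algebra L) (g : forall k, pa_hom (D k) C) :
  (forall i j (h : i <= j) x, g j (ad_mor D h x) = g i x) ->
  exists u : pa_hom dcolim C, (forall k x, u (dcolim_inj k x) = g k x) /\
    forall u' : pa_hom dcolim C,
      (forall k x, u' (dcolim_inj k x) = g k x) -> forall z, u' z = u z.
Proof.
move=> gE; pose u (z : dcolim) := g _ (tagged (repr z)).
have uE k x : u (dcolim_inj k x) = g k x.
  have [m [h [h' e]]] := repr_cls dcolim_equiv (Tagged (fun k => D k : Type) x).
  by rewrite /u -(gE _ _ h) e gE.
have uhom l x y : pa_graph dcolim l x y -> pa_graph C l (u \o x) (u y).
  move=> [k [x' [y' [xy -> ->]]]]; rewrite (uE k y' : u (dcolim_in y') = _).
  rewrite (_ : _ \o _ = g k \o x'); first exact: pa_homP.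
  by apply/funext => i; apply: uE.
exists (PaHom uhom); split=> // u' u'E z.
have [k [x ->]] := dcolim_in_surj z.
by rewrite [LHS](u'E k) [RHS](uE k).
Qed.

End DirectedColimit.

Definition maximal (d : Order.disp_t) (P : porderType d) (p : P) : Prop :=
  forall q : P, p <= q -> q = p.

Definition is_kernel (d : Order.disp_t) (U : porderType d) (V : set U) : Prop :=
  finite_set V /\
  forall u, exists v, [/\ V v, v <= u & forall w, V w -> w <= u -> w <= v].

Definition supported (d : Order.disp_t) (U : porderType d) : Prop :=
  forall F : set U, finite_set F -> exists V, is_kernel V /\ F `<=` V.

Record norm_covering (d : Order.disp_t) (P : porderType d) := NormCovering {
  nc_disp : Order.disp_t;
  nc_poset :> porderType nc_disp;
  nc_norm : nc_poset -> P;
  nc_supported : supported nc_poset;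
  nc_isotone : forall x y, x <= y -> nc_norm x <= nc_norm y }.

Arguments nc_norm {d P _} _.

Definition is_poset_ideal (d : Order.disp_t) (U : porderType d) (u : set U) : Prop :=
  [/\ u !=set0,
      forall x y, u x -> u y -> exists z, [/\ u z, x <= z & y <= z]
    & forall x y, x <= y -> u y -> u x].

(* The norm of a sharp ideal, as a relation: largest elements are unique. *)
Definition has_norm (d : Order.disp_t) (P : porderType d) (U : norm_covering P)
    (u : set U) (p : P) : Prop :=
  (exists2 x, u x & nc_norm x = p) /\ forall x, u x -> nc_norm x <= p.

Definition sharp_ideal (d : Order.disp_t) (P : porderType d) (U : norm_covering P)
    (u : set U) : Prop :=
  is_poset_ideal u /\ exists p, has_norm u p.

Definition nonmax_part (d : Order.disp_t) (P : porderType d) (U : norm_covering P)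
    (UU : set (set U)) : set (set U) :=
  [set u | UU u /\ exists2 p, has_norm u p & ~ maximal p].

Record aleph0_lifter (d : Order.disp_t) (P : porderType d) (U : norm_covering P)
    (UU : set (set U)) : Prop := Aleph0Lifter {
  lifter_sharp : forall u, UU u -> sharp_ideal u;
  lifter_finite : forall u, nonmax_part UU u -> finite_set [set v | UU v /\ v `<=` u];
  lifter_section : forall S : set U -> set U,
    (forall u, nonmax_part UU u -> finite_set (S u)) ->
    exists sigma : P -> set U,
      [/\ forall p, UU (sigma p),
          forall p q, p <= q -> sigma p `<=` sigma q,
          forall p, has_norm (sigma p) p
        & forall p q, p < q -> (S (sigma p) `&` sigma q)%classic `<=` sigma p] }.

Record kernel (d : Order.disp_t) (U : porderType d) := Kernel {
  kernel_set :> set U;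
  kernelP : `[< is_kernel kernel_set >] }.

HB.instance Definition _ (d : Order.disp_t) (U : porderType d) :=
  [isSub for @kernel_set d U].
HB.instance Definition _ (d : Order.disp_t) (U : porderType d) :=
  [Choice of kernel U by <:].
HB.instance Definition _ (d : Order.disp_t) (U : porderType d) :=
  [SubChoice_isSubPOrder of kernel U by <: with set_display].

Section Condensate.
Variables (L : signature) (d : Order.disp_t) (P : porderType d).
Variables (X : norm_covering P) (A : alg_diagram L P).

Lemma kernel_leP (V W : kernel X) : V <= W <-> (V : set X) `<=` W.
Proof. by rewrite -Order.le_val -subsetEset. Qed.

Lemma kernels_directed : directed (kernel X).
Proof.
split.
  have [V [kV _]] := nc_supported (finite_set0 X).
  exact: inhabits (Kernel (introT (asboolP _) kV)).
move=> V W; have /asboolP[fV _] := kernelP V; have /asboolP[fW _] := kernelP W.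
have fVW : finite_set (V `|` W)%classic by rewrite finite_setU.
have [Z [kZ VWZ]] := nc_supported fVW.
exists (Kernel (introT (asboolP _) kZ)); split; apply/kernel_leP => x hx; apply: VWZ.
  by left.
by right.
Qed.

Lemma kernel_floor_ex (V : kernel X) (u : X) :
  exists v : V, val v <= u /\ forall w : V, val w <= u -> val w <= val v.
Proof.
have /asboolP[_ /(_ u)[v [Vv vu h]]] := kernelP V.
exists (exist _ v (mem_set Vv)); split=> //= -[w /= Vw]; apply: h; exact: set_mem.
Qed.

Definition kernel_floor (V : kernel X) (u : X) : V := projT1 (cid (kernel_floor_ex V u)).

Lemma kernel_floor_le (V : kernel X) u : val (kernel_floor V u) <= u.
Proof. by rewrite /kernel_floor; case: cid => v []. Qed.

Lemma kernel_floor_max (V : kernel X) u (w : V) :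
  val w <= u -> val w <= val (kernel_floor V u).
Proof. by rewrite /kernel_floor; case: cid => v [] /= _; apply. Qed.

Definition cond_ob (V : kernel X) : algebra L :=
  prod_alg (fun v : V => A (nc_norm (val v))).

Definition cond_fun (V W : kernel X) (a : cond_ob V) : cond_ob W :=
  fun w => ad_mor A (nc_isotone (kernel_floor_le V (val w)))
             (a (kernel_floor V (val w))).

Arguments cond_fun {V} W a.

Lemma cond_hom (V W : kernel X) l x y : pa_graph (cond_ob V) l x y ->
  pa_graph (cond_ob W) l (@cond_fun V W \o x) (cond_fun W y).
Proof.
by move=> xy w; apply: (pa_homP (ad_mor A (nc_isotone (kernel_floor_le V (val w))))) (xy _).
Qed.

Lemma cond_transport (V : kernel X) (a : cond_ob V) (v w : V) (p : P)
    (h : nc_norm (val v) <= p) (h' : nc_norm (val w) <= p) :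
  v = w -> ad_mor A h (a v) = ad_mor A h' (a w).
Proof. by move=> vw; subst w; rewrite (bool_irrelevance h h'). Qed.

Lemma cond_id (V : kernel X) (VV : V <= V) (a : cond_ob V) : cond_fun V a = a.
Proof.
apply: functional_extensionality_dep => w; rewrite /cond_fun.
rewrite (@cond_transport V a _ w _ _ (lexx _)) ?ad_id //.
by apply/val_inj/le_anti; rewrite kernel_floor_le kernel_floor_max.
Qed.

Lemma cond_comp (V W Z : kernel X) (VW : V <= W) (WZ : W <= Z) (VZ : V <= Z)
  (a : cond_ob V) : cond_fun Z a = cond_fun Z (cond_fun W a).
Proof.
apply: functional_extensionality_dep => z; rewrite /cond_fun.
set w := kernel_floor W (val z).
have h : nc_norm (val (kernel_floor V (val w))) <= nc_norm (val z).
  exact/nc_isotone/(le_trans (kernel_floor_le V _))/kernel_floor_le.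
rewrite -(ad_comp _ _ h).
apply: cond_transport; apply/val_inj/le_anti/andP; split; last first.
  by apply/kernel_floor_max/(le_trans (kernel_floor_le V _))/kernel_floor_le.
apply: kernel_floor_max.
have Wv : (W : set X) (val (kernel_floor V (val z))).
  by apply/(kernel_leP V W).1 => //; apply: set_mem; case: (kernel_floor V _).
exact: (@kernel_floor_max W (val z) (SigSub (mem_set Wv)) (kernel_floor_le V _)).
Qed.

Definition cond_diagram : alg_diagram L (kernel X) :=
  @AlgDiagram L _ (kernel X) cond_ob (fun V W _ => PaHom (@cond_hom V W))
    cond_id cond_comp.

Definition condensate : algebra L := dcolim cond_diagram kernels_directed.

End Condensate.

(* A partial subalgebra has its own operations, given by their graphs [ps_graph];
   their domains may be smaller than those induced by [A]. *)
Record psub (L : signature) (A : partial_algebra L) := PSub {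
  ps_set :> A -> Prop;
  ps_graph : forall l : symbol L, ('I_(arity l) -> A) -> A -> Prop;
  ps_graph_sub : forall l (x : 'I_(arity l) -> A) y, ps_graph x y ->
    [/\ forall i, ps_set (x i), ps_set y & pa_graph A l x y] }.

Arguments ps_graph {L A} _ l _ _.

Lemma psub_full_sub (L : signature) (A : partial_algebra L) (l : symbol L)
    (x : 'I_(arity l) -> A) y : pa_graph A l x y ->
  [/\ forall i, [set: A] (x i), [set: A] y & pa_graph A l x y].
Proof. by []. Qed.

Definition psub_full (L : signature) (A : partial_algebra L) : psub A :=
  PSub (@psub_full_sub L A).

Section PSubImage.
Variables (L : signature) (A B : partial_algebra L) (f : pa_hom A B) (X : psub A).

Definition image_graph (l : symbol L) (x : 'I_(arity l) -> B) (y : B) : Prop :=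
  exists x' y', [/\ ps_graph X l x' y', x = f \o x' & y = f y'].

Lemma image_graph_sub l (x : 'I_(arity l) -> B) y : image_graph x y ->
  [/\ forall i, (f @` ps_set X) (x i), (f @` ps_set X) y & pa_graph B l x y].
Proof.
move=> [x' [y' [xy -> ->]]]; have [hx hy /(pa_homP f) ?] := ps_graph_sub xy.
by split=> [i||] //; exists (x' i).
Qed.

Definition psub_image : psub B := PSub image_graph_sub.

End PSubImage.

Definition psub_le (L : signature) (A : partial_algebra L) (X Y : psub A) : Prop :=
  ps_set X `<=` ps_set Y /\ forall l x y, ps_graph X l x y -> ps_graph Y l x y.

Definition psub_strong (L : signature) (A : partial_algebra L) (X Y : psub A) : Prop :=
  psub_le X Y /\
  forall l (x : 'I_(arity l) -> A), (forall i, X (x i)) -> exists y, ps_graph Y l x y.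

Record pregamp (L : signature) := Pregamp {
  pg_pa :> partial_algebra L;
  pg_semi : semilattice;
  pg_dist : pg_pa -> pg_pa -> pg_semi;
  pg_dist0 : forall x y, pg_dist x y = \bot <-> x = y;
  pg_dist_sym : forall x y, pg_dist x y = pg_dist y x;
  pg_dist_tri : forall x y z, pg_dist x y <= pg_dist x z `|` pg_dist z y;
  pg_dist_op : forall l x y a b, pa_graph pg_pa l x a -> pa_graph pg_pa l y b ->
    pg_dist a b <= \join_(k < arity l) pg_dist (x k) (y k) }.

Section PregampQuotient.
Variables (L : signature) (A : pregamp L) (I : ideal (pg_semi A)).

Definition pgq_rel (x y : A) : Prop := I (pg_dist x y).

Lemma pgq_equiv : Equivalence pgq_rel.
Proof.
split.
- by move=> x; rewrite /pgq_rel (pg_dist0 x x).2 //; apply: ideal0.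
- by move=> x y; rewrite /pgq_rel pg_dist_sym.
- move=> x y z Ixy Iyz; apply: ideal_lower (pg_dist_tri x z y) _; exact: idealU.
Qed.

Definition pgq_pi (x : A) : quot pgq_rel := cls pgq_rel x.

Lemma pgq_pi_eq x y : pgq_pi x = pgq_pi y <-> I (pg_dist x y).
Proof. exact: (cls_eq pgq_equiv x y). Qed.

Definition pgq_graph (l : symbol L) (X : 'I_(arity l) -> quot pgq_rel)
    (Y : quot pgq_rel) : Prop :=
  exists x y, [/\ pa_graph A l x y, X = pgq_pi \o x & Y = pgq_pi y].

Lemma ideal_join n (s : 'I_n -> pg_semi A) :
  (forall i, I (s i)) -> I (\join_(i < n) s i).
Proof.
by move=> h; elim/big_ind: _ => // [|x y]; [apply: ideal0 | apply: idealU].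
Qed.

Lemma pgq_functional l (X : 'I_(arity l) -> quot pgq_rel) Y Z :
  pgq_graph X Y -> pgq_graph X Z -> Y = Z.
Proof.
move=> [x [y [xy -> ->]]] [x' [y' [xy' e ->]]].
apply/pgq_pi_eq; apply: ideal_lower (pg_dist_op xy xy') (ideal_join _) => i.
by apply/pgq_pi_eq; apply: (congr1 (fun f => f i) e).
Qed.

Definition pgq_pa : partial_algebra L := PartialAlgebra pgq_functional.

Definition pgq_dist (X Y : pgq_pa) : semi_quot I :=
  semi_pi I (pg_dist (repr X) (repr Y)).

Lemma pgq_distE x y : pgq_dist (pgq_pi x) (pgq_pi y) = semi_pi I (pg_dist x y).
Proof.
have h z : I (pg_dist (repr (pgq_pi z)) z) := repr_cls pgq_equiv z.
apply/semi_pi_eq.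
exists (pg_dist (repr (pgq_pi x)) x `|` pg_dist (repr (pgq_pi y)) y); first exact: idealU.
set u := repr _; set v := repr _.
apply/le_anti/andP; split; rewrite leUx leUr andbT.
  apply: le_trans (pg_dist_tri u v x) _; rewrite joinCA leU2 ?lexx //.
  apply: le_trans (pg_dist_tri x v y) _.
  by rewrite leU2 ?lexx // pg_dist_sym.
apply: le_trans (pg_dist_tri x y u) _; rewrite (pg_dist_sym x u) joinCA leU2 ?lexx //.
exact: pg_dist_tri.
Qed.

Lemma pgq_surj (X : pgq_pa) : exists x, X = pgq_pi x.
Proof. exact: cls_surj. Qed.

Lemma pgq_dist0 X Y : pgq_dist X Y = \bot <-> X = Y.
Proof.
have [x ->] := pgq_surj X; have [y ->] := pgq_surj Y.
by rewrite pgq_distE semi_pi_eq0 pgq_pi_eq.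
Qed.

Lemma pgq_dist_sym X Y : pgq_dist X Y = pgq_dist Y X.
Proof.
have [x ->] := pgq_surj X; have [y ->] := pgq_surj Y.
by rewrite !pgq_distE pg_dist_sym.
Qed.

Lemma semi_pi_mono x y : x <= y -> semi_pi I x <= semi_pi I y.
Proof.
by move=> h; apply/semi_pi_le; exists \bot; [apply: ideal0 | rewrite joinx0].
Qed.

Lemma pgq_dist_tri X Y Z : pgq_dist X Y <= pgq_dist X Z `|` pgq_dist Z Y.
Proof.
have [x ->] := pgq_surj X; have [y ->] := pgq_surj Y; have [z ->] := pgq_surj Z.
by rewrite !pgq_distE -(semi_pi_hom I).2; apply/semi_pi_mono/pg_dist_tri.
Qed.

Lemma pgq_dist_op l X Y a b : pa_graph pgq_pa l X a -> pa_graph pgq_pa l Y b ->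
  pgq_dist a b <= \join_(k < arity l) pgq_dist (X k) (Y k).
Proof.
move=> [x [a' [xa -> ->]]] [y [b' [yb -> ->]]].
rewrite pgq_distE; under eq_bigr do rewrite pgq_distE.
rewrite -(big_morph (semi_pi I) (semi_pi_hom I).2 (semi_pi_hom I).1).
exact/semi_pi_mono/pg_dist_op.
Qed.

Definition pregamp_quot : pregamp L :=
  Pregamp pgq_dist0 pgq_dist_sym pgq_dist_tri pgq_dist_op.

Lemma pgq_pi_homP l x y : pa_graph A l x y ->
  pa_graph pregamp_quot l (pgq_pi \o x) (pgq_pi y).
Proof. by move=> xy; exists x, y. Qed.

Definition pgq_proj : pa_hom A pregamp_quot := PaHom pgq_pi_homP.

End PregampQuotient.

Definition pregamp_of (L : signature) (V : algebra L -> Prop) (A : pregamp L) : Prop :=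
  forall (I : ideal (pg_semi A)) e, identity_of V e -> satisfies (pregamp_quot I) e.

Record gamp (L : signature) := Gamp {
  gp_pregamp :> pregamp L;
  gp_star : psub gp_pregamp }.

Definition gamp_of (L : signature) (V : algebra L -> Prop) (A : gamp L) : Prop :=
  pregamp_of V A.

Definition gamp_finite (L : signature) (A : gamp L) : Prop :=
  finite_set [set: A] /\ finite_set [set: pg_semi A].

Record gamp_hom (L : signature) (A B : gamp L) := GampHom {
  gh_fun :> pa_hom A B;
  gh_semi : pg_semi A -> pg_semi B;
  gh_semihom : is_semihom gh_semi;
  gh_dist : forall x y, pg_dist (gh_fun x) (gh_fun y) = gh_semi (pg_dist x y);
  gh_star : psub_le (psub_image gh_fun (gp_star A)) (gp_star B) }.

Definition gamp_isomorphic (L : signature) (A B : gamp L) : Prop :=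
  exists (f : gamp_hom A B) (g : gamp_hom B A),
    [/\ cancel f g, cancel g f, cancel (gh_semi f) (gh_semi g)
      & cancel (gh_semi g) (gh_semi f)].

Definition gamp_quot (L : signature) (A : gamp L) (I : ideal (pg_semi A)) : gamp L :=
  @Gamp L (pregamp_quot I) (psub_image (pgq_proj I) (gp_star A)).

Definition gamp_of_alg (L : signature) (B : algebra L) : gamp L :=
  @Gamp L (Pregamp (@Theta0 L B) (@Theta_sym L B) (@Theta_tri L B) (@Theta_op L B))
    (psub_full B).

(* [A] is regarded as a partial subalgebra of [A'] through the one-to-one
   morphism [i]. *)
Definition is_realization (L : signature) (V : algebra L -> Prop) (A : gamp L)
    (A' : algebra L) (i : pa_hom A A') (chi : pg_semi A -> conc A') : Prop :=
  [/\ V A', injective i, is_semihom chi, injective chi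
    & forall x y, chi (pg_dist x y) = Theta (i x) (i y)].

Definition has_iso_realization (L : signature) (V : algebra L -> Prop) (A : gamp L) : Prop :=
  exists (A' : algebra L) (i : pa_hom A A') (chi : pg_semi A -> conc A'),
    is_realization V i chi /\ bijective chi.

Definition gamp_strong (L : signature) (A : gamp L) : Prop :=
  psub_strong (gp_star A) (psub_full A).

Definition distance_generated (L : signature) (A : gamp L) : Prop :=
  forall s : pg_semi A, exists n (x y : 'I_n -> A),
    (forall k, gp_star A (x k) /\ gp_star A (y k)) /\
    s = \join_(k < n) pg_dist (x k) (y k).

Definition val3 (T : Type) m r (x y : 'I_m -> T) (z : 'I_r -> T)
    (v : 'I_m + 'I_m + 'I_r) : T :=
  match v with
  | inl (inl k) => x k
  | inl (inr k) => y k
  | inr k => z k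
  end.

Definition congruence_tractable (L : signature) (A : gamp L) : Prop :=
  forall (x y : A) m (xs ys : 'I_m -> A),
    gp_star A x -> gp_star A y ->
    (forall k, gp_star A (xs k) /\ gp_star A (ys k)) ->
    pg_dist x y <= \join_(k < m) pg_dist (xs k) (ys k) ->
    exists (n : nat) (r : nat) (zs : 'I_r -> A)
           (t : nat -> term L ('I_m + 'I_m + 'I_r)),
      [/\ (0 < n)%N,
          term_val (val3 xs ys zs) (t 0%N) x,
          term_val (val3 xs ys zs) (t n) y
        & forall k, (k < n)%N -> exists c,
            term_val (val3 ys xs zs) (t k) c /\ term_val (val3 xs ys zs) (t k.+1) c].

Definition gamp_hom_strong (L : signature) (A B : gamp L) (f : gamp_hom A B) : Prop :=
  psub_strong (psub_image f (psub_full A)) (gp_star B).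

(* The finite subset of the semilattice is given by a list of its elements. *)
Definition congruence_cuttable (L : signature) (A B : gamp L) (f : gamp_hom A B) : Prop :=
  psub_le (psub_image f (psub_full A)) (gp_star B) /\
  forall (X : seq (pg_semi B)) (x y : A),
    pg_dist (f x) (f y) <= \join_(s <- X) s ->
    exists (n : nat) (c : nat -> B),
      [/\ c 0%N = f x, c n = f y,
          forall k, (k <= n)%N -> gp_star B (c k)
        & forall k, (k < n)%N -> exists2 s, s \in X & pg_dist (c k) (c k.+1) <= s].

Record gamp_diagram (L : signature) (d : Order.disp_t) (P : porderType d) := GampDiagram {
  gd_ob :> P -> gamp L;
  gd_mor : forall p q, p <= q -> gamp_hom (gd_ob p) (gd_ob q);
  gd_id : forall p (pp : p <= p),
    (forall x, gd_mor pp x = x) /\ (forall s, gh_semi (gd_mor pp) s = s);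
  gd_comp : forall p q r (pq : p <= q) (qr : q <= r) (pr : p <= r),
    (forall x, gd_mor pr x = gd_mor qr (gd_mor pq x)) /\
    (forall s, gh_semi (gd_mor pr) s = gh_semi (gd_mor qr) (gh_semi (gd_mor pq) s)) }.

Definition semi_of_gamps (L : signature) (d : Order.disp_t) (P : porderType d)
    (A : gamp_diagram L P) : semi_diagram P :=
  @SemiDiagram d P (fun p => pg_semi (A p)) (fun p q pq => gh_semi (gd_mor A pq))
    (fun p q pq => gh_semihom (gd_mor A pq))
    (fun p pp => (@gd_id L d P A p pp).2)
    (fun p q r pq qr pr => (@gd_comp L d P A p q r pq qr pr).2).

Record partial_lifting (L : signature) (V : algebra L -> Prop) (d : Order.disp_t)
    (P : porderType d) (A : gamp_diagram L P) : Prop := PartialLifting {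
  pl_variety : forall p, gamp_of V (A p);
  pl_strong : forall p, gamp_strong (A p);
  pl_tractable : forall p, congruence_tractable (A p);
  pl_generated : forall p, distance_generated (A p);
  pl_realization : forall p, has_iso_realization V (A p);
  pl_mor_strong : forall p q (pq : p <= q), p < q -> gamp_hom_strong (gd_mor A pq);
  pl_mor_cuttable : forall p q (pq : p <= q), p < q -> congruence_cuttable (gd_mor A pq) }.

Definition partial_lifting_of (L : signature) (V : algebra L -> Prop) (d : Order.disp_t)
    (P : porderType d) (A : gamp_diagram L P) (S : semi_diagram P) : Prop :=
  partial_lifting V A /\ semi_diagram_iso (semi_of_gamps A) S.

(* Main.v *)
Require Import Defs.
From mathcomp Require Import all_boot all_order.
From mathcomp Require Import boolp classical_sets cardinality.

Set Implicit Arguments.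
Unset Strict Implicit.
Unset Printing Implicit Defensive.

Import Order.TTheory.

Local Open Scope classical_set_scope.
Local Open Scope order_scope.

(* A sharp ideal u of X with norm p induces a surjective homomorphism from the
   condensate onto A_p, hence, through the given isomorphism, a surjection rho_u
   from Con_c B onto Con_c A_p that identifies Con_c A_p with Con_c (B / theta_u),
   where theta_u consists of the pairs (x, y) with rho_u (Theta (x, y)) = 0. The
   gamp attached to p is B / theta_u itself if p is maximal, and otherwise the
   image in B / theta_u of a finite subset C_u of B, with values of the distance
   in Con_c A_p. As only finitely many members of the lifter lie below u, the sets
   C_u can be chosen by well-founded recursion so that C_u contains C_v and the
   values of the operations on C_v for v below u, together with finitely many
   elements that generate the distances, cut them, and witness Mal'cev's
   description of the principal congruences; finiteness of Con_c A_p leaves only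
   finitely many instances to be witnessed. The congruences Theta (a, b), for a, b
   in C_u or among the values of the operations on C_u, all come from one kernel S(u)
   of X. If sigma is the section that the lifter provides for S and p < q, then
   S(sigma p) does not meet sigma q outside sigma p, so on these congruences
   rho_(sigma q) is rho_(sigma p) followed by Con_c A_p -> Con_c A_q. Hence the
   identity of B induces the transition morphisms. *)

(** * Finite sets and chains *)

Lemma finite_enum T (A : set T) :
  finite_set A -> exists k (e : 'I_k -> T), A = e @` setT.
Proof.
move=> fA; have [s As] := (finite_seqP (T := {classic T}) A).1 fA.
exists (size s), (tnth (in_tuple s)); rewrite As.
apply/seteqP; split=> [x /= xs|_ [i _ <-] /=]; last exact: mem_tnth.
by have /tnthP[i ->] : x \in in_tuple s by []; exists i.
Qed.

Lemma finite_subsets T (A : set T) :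
  finite_set A -> finite_set [set S : set T | S `<=` A].
Proof.
move=> /finite_enum[k [e ->]].
apply: sub_finite_set (finite_image (fun D : {set 'I_k} => e @` [set i | i \in D])
  (finite_finset (X := setT))).
move=> S SA; exists [set i | `[< S (e i) >]]%SET => //.
apply/seteqP; split=> [_ [i /= + <-]|x Sx]; first by rewrite inE => /asboolP.
have [i _ eix] := SA _ Sx; exists i; last exact: eix.
by rewrite /= inE; apply/asboolP; rewrite eix.
Qed.

Lemma finite_families T (A : set T) n :
  finite_set A -> finite_set [set x : 'I_n -> T | forall i, A (x i)].
Proof.
move=> /finite_enum[k [e ->]].
apply: sub_finite_set (finite_image (fun (g : {ffun 'I_n -> 'I_k}) i => e (g i))
  (finite_finset (X := setT))).
move=> x /= xA; have [g gE] := choice (fun i => (fun '(ex_intro2 j _ h) =>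
  ex_intro (fun j => e j = x i) j h) (xA i)).
by exists (finfun g) => //; apply/funext => i; rewrite ffunE.
Qed.

Lemma finite_sig T (A : set T) : finite_set A -> finite_set [set: {x | A x}].
Proof.
move=> /finite_enum[k [e AE]].
have Ae i : A (e i) by rewrite AE; exists i.
apply: sub_finite_set (finite_image (fun i => exist A (e i) (Ae i))
  (finite_finset (X := setT))).
move=> [x Ax] _; have [i _ eix] : (e @` setT) x by rewrite -AE.
by exists i => //; apply: eq_exist.
Qed.

(** Binary upper bounds extend to finitely many requirements by induction on an enumeration. The
    index may be a finite set, a compact congruence, a member of a poset ideal or a kernel;
    [inhabited K] covers an empty list of requirements. *)
Lemma finite_directed T K (X : set T) (P : T -> K -> Prop) :
  finite_set X -> inhabited K ->
  (forall k k', exists m, forall x, P x k \/ P x k' -> P x m) ->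
  (forall x, X x -> exists k, P x k) -> exists k, forall x, X x -> P x k.
Proof.
move=> /finite_enum[n [e ->]] [k0] dirP hP.
have [k ke] := choice (fun i => hP (e i) (ex_intro2 _ _ i I erefl)).
suff [m hm] : exists m, forall i, i \in enum 'I_n -> P (e i) m.
  by exists m => _ [i _ <-]; apply: hm; rewrite mem_enum.
elim: (enum _) => [|j s [m hm]]; first by exists k0.
have [m' hm'] := dirP (k j) m; exists m' => i; rewrite inE => /orP[/eqP->|/hm].
  by apply: hm'; left.
by move=> h; apply: hm'; right.
Qed.

Lemma finite_witness I T (X : set I) (P : I -> set T -> Prop) :
  finite_set X -> (forall i G G', G `<=` G' -> P i G -> P i G') ->
  (forall i, X i -> exists2 G, finite_set G & P i G) ->
  exists2 G, finite_set G & forall i, X i -> P i G.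
Proof.
move=> fX Pmono hP.
have [||i Xi|[G fG] hG] :=
    @finite_directed I {G : set T | finite_set G} X (fun i G => P i (sval G)) fX.
- by split; exists set0.
- move=> [G fG] [G' fG'].
  have fGG' : finite_set (G `|` G')%classic by rewrite finite_setU.
  by exists (exist _ _ fGG') => i [] /=; apply: Pmono => x; [left|right].
- by have [G fG PG] := hP i Xi; exists (exist _ G fG).
- by exists G.
Qed.

Section Chains.
Variable T : Type.

(** Only the values of [c] up to [n] matter; [congruence_cuttable] has the same form. *)
Definition chain (R : T -> T -> Prop) (x y : T) : Prop :=
  exists n (c : nat -> T),
    [/\ c 0%N = x, c n = y & forall k, (k < n)%N -> R (c k) (c k.+1)].

Lemma chain_refl R x : chain R x x.
Proof. by exists 0%N, (fun=> x). Qed.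

Lemma chain1 (R : T -> T -> Prop) x y : R x y -> chain R x y.
Proof. by move=> h; exists 1%N, (fun k => if k is 0%N then x else y); split=> // -[]. Qed.

Lemma chain_trans R x y z : chain R x y -> chain R y z -> chain R x z.
Proof.
move=> [n [c [c0 cn hc]]] [m [e [e0 em he]]].
exists (n + m)%N, (fun k => if (k < n)%N then c k else e (k - n)%N); split.
- by case: posnP => // n0; rewrite n0 subnn e0 -cn n0.
- by rewrite ltnNge leq_addr /= addKn.
- move=> k km; case: ltnP => kn; last first.
    rewrite ltnNge (leqW kn) /= subSn //; apply: he.
    by rewrite ltn_subLR.
  case: ltnP => [_|nk]; first exact: hc.
  have nE : n = k.+1 by apply/eqP; rewrite eqn_leq nk kn.
  by have := hc k; rewrite -nE subnn cn e0 nE; apply.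
Qed.

Lemma chain_sym (R : T -> T -> Prop) x y :
  (forall x y, R x y -> R y x) -> chain R x y -> chain R y x.
Proof.
move=> symR [n [c [c0 cn hc]]]; exists n, (fun k => c (n - k)%N); split.
- by rewrite subn0.
- by rewrite subnn.
- move=> k kn; apply: symR; rewrite subnS.
  have := hc (n - k).-1; rewrite prednK ?subn_gt0 //.
  by apply; apply: leq_subr.
Qed.

End Chains.

Lemma chain_map T U (R : T -> T -> Prop) (R' : U -> U -> Prop) (f : T -> U) x y :
  (forall x y, R x y -> R' (f x) (f y)) -> chain R x y -> chain R' (f x) (f y).
Proof.
move=> Rf [n [c [c0 cn hc]]]; exists n, (f \o c) => /=.
by rewrite c0 cn; split=> // k kn; apply/Rf/hc.
Qed.

Lemma chain_le T (R R' : T -> T -> Prop) x y :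
  (forall a b, R a b -> R' a b) -> chain R x y -> chain R' x y.
Proof. exact: (@chain_map _ _ R R' id). Qed.

Lemma chain_finite T (R : T -> T -> Prop) x y : chain R x y ->
  exists2 G, finite_set G & chain (fun a b => [/\ G a, G b & R a b]) x y.
Proof.
move=> [n [c [c0 cn hc]]]; exists [set c (val k) | k in [set: 'I_n.+1]].
  exact/finite_image/finite_finset.
exists n, c; split=> // k kn; split; last exact: hc.
  by exists (Ordinal (leqW kn)).
by exists (Ordinal (kn : k.+1 < n.+1)%N).
Qed.

(** * Terms and Mal'cev chains *)

Section Terms.
Variable L : signature.

(** A strengthening of [term_val]: [G] must contain the values of all subterms, as definedness in
    the partial algebra carried by [G] requires. *)
Fixpoint term_in (A : partial_algebra L) (G : set A) (X : Type) (v : X -> A)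
    (t : term L X) (a : A) : Prop :=
  G a /\ match t with
  | Var x => a = v x
  | App l ts =>
      exists b, (forall i, term_in G v (ts i) (b i)) /\ pa_graph A l b a
  end.

Fixpoint term_vars (X : Type) (D : set X) (t : term L X) : Prop :=
  match t with
  | Var x => D x
  | App l ts => forall i, term_vars D (ts i)
  end.

Fixpoint term_map (X Y : Type) (g : X -> Y) (t : term L X) : term L Y :=
  match t with
  | Var x => Var (g x)
  | App l ts => App l (fun i => term_map g (ts i))
  end.

Lemma term_in_le (A : partial_algebra L) (G G' : set A) X (v : X -> A) t a :
  G `<=` G' -> term_in G v t a -> term_in G' v t a.
Proof.
move=> GG'; elim: t a => [x|l ts IH] a /= [/GG' Ga]; first by split.
by move=> [b [hb ba]]; split=> //; exists b; split=> // i; apply: IH.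
Qed.

Lemma term_in_finite (A : partial_algebra L) X (v : X -> A) t a :
  term_in setT v t a -> exists2 G, finite_set G & term_in G v t a.
Proof.
elim: t a => [x|l ts IH] a [_].
  by move=> ->; exists [set v x]; [apply: finite_set1 | split].
move=> [b [hb ba]].
have [|||G fG hG] := @finite_witness _ _ setT (fun i G => term_in G v (ts i) (b i)).
- exact: finite_finset.
- by move=> i G G' /term_in_le h /=; apply: h.
- by move=> i _; apply: IH; apply: hb.
exists (a |` G); first by rewrite finite_setU; split=> //; apply: finite_set1.
split; [by left | exists b; split=> // i].
by apply: term_in_le (hG i I) => x; right.
Qed.

Lemma term_in_map (A : partial_algebra L) (G : set A) X Y (g : X -> Y) (v : Y -> A) t a :
  term_in G v (term_map g t) a <-> term_in G (v \o g) t a.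
Proof.
elim: t a => [x|l ts IH] a /=; first by split.
split=> -[Ga [b [hb ba]]]; split=> //;
  by exists b; split=> // i; apply/IH.
Qed.

Lemma term_vars_le X (D D' : set X) t : D `<=` D' -> term_vars D t -> term_vars D' t.
Proof. by move=> DD'; elim: t => [x|l ts IH] /= => [/DD'|h i] //; apply: IH. Qed.

Lemma term_vars_map X Y (g : X -> Y) (D : set Y) t :
  term_vars D (term_map g t) <-> term_vars (g @^-1` D) t.
Proof. by elim: t => [x|l ts IH] //=; split=> h i; apply/IH. Qed.

Lemma term_vars_finite X (D : set X) t : term_vars D t ->
  exists2 F, finite_set F & term_vars (D `&` F)%classic t.
Proof.
elim: t => [x|l ts IH] /= h; first by exists [set x]; [apply: finite_set1 | split].
have [|||F fF hF] := @finite_witness _ _ setT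
    (fun i F => term_vars (D `&` F)%classic (ts i)).
- exact: finite_finset.
- by move=> i F F' FF'; apply: term_vars_le => x [? /FF'].
- by move=> i _; apply: IH.
by exists F => // i; apply: hF.
Qed.

Lemma term_vars_range X Y (g : X -> Y) t :
  term_vars (range g) t -> exists t', t = term_map g t'.
Proof.
elim: t => [y|l ts IH] /= h; first by have [x _ <-] := h; exists (Var x).
have [ts' tsE] := choice (fun i => IH i (h i)).
by exists (App l ts') => /=; congr App; apply/funext.
Qed.

Lemma term_val_fun (A : partial_algebra L) X (v : X -> A) t a b :
  term_val v t a -> term_val v t b -> a = b.
Proof.
elim: t a b => [x|l ts IH] a b /=; first by move=> -> ->.
move=> [x [hx xa]] [y [hy yb]]; apply: pa_functional xa _.
by have -> : x = y by apply/funext => i; apply: IH.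
Qed.

Lemma term_val_total (A : algebra L) X (v : X -> A) t : exists a, term_val v t a.
Proof.
elim: t => [x|l ts IH] /=; first by exists (v x).
have [b hb] := choice IH; have [a ba] := alg_total b.
by exists a, b.
Qed.

Lemma term_val_hom (A B : partial_algebra L) (f : pa_hom A B) X (v : X -> A) t a :
  term_val v t a -> term_val (f \o v) t (f a).
Proof.
elim: t a => [x|l ts IH] a /=; first by move=> ->.
move=> [b [hb ba]]; exists (f \o b); split; last exact: pa_homP ba.
by move=> i; apply: IH.
Qed.

Lemma satisfies_inj (A B : partial_algebra L) (f : pa_hom A B) e :
  injective f -> satisfies B e -> satisfies A e.
Proof. by move=> fi Be v a b ha hb; apply/fi/(Be (f \o v)); apply: term_val_hom. Qed.

Lemma satisfies_surj (A : algebra L) (B : partial_algebra L) (f : pa_hom A B) e :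
  (forall y, exists x, f x = y) -> satisfies A e -> satisfies B e.
Proof.
move=> fs Ae v a b ha hb; have [u uE] := choice (fun n => fs (v n)).
have vE : v = f \o u by apply/funext => n /=.
have [a' ha'] := term_val_total u e.1; have [b' hb'] := term_val_total u e.2.
rewrite (term_val_fun ha (_ : term_val v e.1 (f a'))); last first.
  by rewrite vE; apply: term_val_hom.
rewrite (term_val_fun hb (_ : term_val v e.2 (f b'))); last first.
  by rewrite vE; apply: term_val_hom.
by rewrite (Ae _ _ _ ha' hb').
Qed.

Lemma variety_surj (V : algebra L -> Prop) (A B : algebra L) (f : pa_hom A B) :
  is_variety V -> (forall y, exists x, f x = y) -> V A -> V B.
Proof.
move=> [E VE] fs /VE VA; apply/VE => e /VA; exact: satisfies_surj.
Qed.

End Terms.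

Section UnaryCongruence.
Variables (L : signature) (A : algebra L).

Definition upd n (x : 'I_n -> A) (i : 'I_n) (a : A) : 'I_n -> A :=
  fun k => if k == i then a else x k.

(** Arguments are exchanged one at a time; totality of [A] supplies the intermediate values. *)
Lemma unary_congruence (th : set (A * A)) :
  (forall x, th (x, x)) -> (forall x y, th (x, y) -> th (y, x)) ->
  (forall x y z, th (x, y) -> th (y, z) -> th (x, z)) ->
  (forall l i (x : 'I_(arity l) -> A) a b u v, th (a, b) ->
    pa_graph A l (upd x i a) u -> pa_graph A l (upd x i b) v -> th (u, v)) ->
  is_congruence th.
Proof.
move=> r s t h; split=> // l x y a b xy xa yb.
pose z j (k : 'I_(arity l)) := if (k < j)%N then y k else x k.
suff H j : (j <= arity l)%N -> forall c, pa_graph A l (z j) c -> th (a, c).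
  apply: (H (arity l)) => //; rewrite (_ : z _ = y) //.
  by apply/funext => k; rewrite /z ltn_ord.
elim: j => [|j IH] jl c.
  rewrite (_ : z 0%N = x); last by apply/funext.
  by move=> /(pa_functional xa) <-.
move=> zc; have [d zd] := alg_total (z j).
apply: t (IH (ltnW jl) _ zd) _.
pose i := Ordinal jl; apply: (h l i (z j) (x i) (y i)) => //.
  rewrite (_ : upd _ _ _ = z j) //; apply/funext => k; rewrite /upd.
  by case: eqP => // ->; rewrite /z ltnn.
rewrite (_ : upd _ _ _ = z j.+1) //; apply/funext => k; rewrite /upd /z.
have [->|ki] := eqVneq k i; first by rewrite ltnSn.
have kj : k != j :> nat by apply: contra ki => /eqP kj; apply/eqP/val_inj.
by rewrite ltnS [in RHS]leq_eqVlt (negbTE kj).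
Qed.

(** Unary translations map chains to chains step by step. Both Mal'cev's description and the cutting
    of distances rest on this. *)
Lemma chain_congruence (R : A -> A -> Prop) :
  (forall x y, R x y -> R y x) ->
  (forall l i (x : 'I_(arity l) -> A) a b u v, R a b ->
    pa_graph A l (upd x i a) u -> pa_graph A l (upd x i b) v -> R u v) ->
  is_congruence [set z | chain R z.1 z.2].
Proof.
move=> Rsym Rop; apply: unary_congruence => /=.
- exact: chain_refl.
- by move=> x y; apply: chain_sym.
- by move=> x y z; apply: chain_trans.
move=> l i x a b u v ab ua vb.
have [f fE] := choice (fun c => alg_total (upd x i c)).
rewrite (pa_functional ua (fE a)) (pa_functional vb (fE b)).
by apply: chain_map ab => c e ce; apply: Rop ce (fE c) (fE e).
Qed.

End UnaryCongruence.

Section Malcev.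
Variables (L : signature) (A : algebra L) (S : set (A * A)).

(* Variables [inl p] stand for pairs of [S] or their reverses, variables [inr c]
   for parameters; a Mal'cev step exchanges the components of all pairs. *)
Definition fst_val (q : A * A + A) : A := match q with inl p => p.1 | inr c => c end.
Definition snd_val (q : A * A + A) : A := match q with inl p => p.2 | inr c => c end.

Definition malcev_var : set (A * A + A) :=
  fun q => match q with inl p => S p \/ S (p.2, p.1) | inr _ => True end.

(** The set [G] holds all values met in the two evaluations, so that the step survives in the
    partial algebra carried by [G]. *)
Definition malcev_step (G : set A) (a b : A) : Prop :=
  exists t : term L (A * A + A),
    [/\ term_vars malcev_var t, term_in G fst_val t a & term_in G snd_val t b].

Lemma malcev_step_sym G a b : malcev_step G a b -> malcev_step G b a.
Proof.
pose g (q : A * A + A) : A * A + A :=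
  match q with inl p => inl (p.2, p.1) | inr c => inr c end.
move=> [t [tv ta tb]]; exists (term_map g t); split.
- by apply/term_vars_map; apply: term_vars_le tv => -[[x y]|c] //= []; [right|left].
- by apply/term_in_map; rewrite (_ : _ \o g = snd_val) //; apply/funext => -[].
- by apply/term_in_map; rewrite (_ : _ \o g = fst_val) //; apply/funext => -[].
Qed.

Lemma malcev_step_le G G' a b : G `<=` G' -> malcev_step G a b -> malcev_step G' a b.
Proof. by move=> GG' [t [tv ta tb]]; exists t; split=> //; apply: term_in_le GG' _. Qed.

Lemma malcev_congruence : is_congruence [set z | chain (malcev_step setT) z.1 z.2].
Proof.
apply: chain_congruence => [x y|l i x a b u v [t [tv ta tb]] ua vb].
  exact: malcev_step_sym.
(* The term [t] takes the place of argument [i]; the other arguments become parameters. *)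
pose ts k : term L (A * A + A) := if k == i then t else Var (inr (x k)).
exists (App l ts); split=> /=.
- by move=> k; rewrite /ts; case: ifP.
- by split=> //; exists (upd x i a); split=> // k; rewrite /ts /upd; case: ifP.
- by split=> //; exists (upd x i b); split=> // k; rewrite /ts /upd; case: ifP.
Qed.

(** Mal'cev chains form a congruence that contains [S]. A chain has finitely many steps and each
    term finitely many subterms, hence a finite [G]. *)
Lemma malcev_chain x y : cgen S (x, y) ->
  exists2 G, finite_set G & chain (malcev_step G) x y.
Proof.
move=> Sxy; have [n [c [c0 cn hc]]] : chain (malcev_step setT) x y.
  apply: (Sxy [set z | chain (malcev_step setT) z.1 z.2]); split.
    exact: malcev_congruence.
  move=> [a b] Sab /=; apply: chain1; exists (Var (inl (a, b))); split=> //=.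
  by left.
have [||k _|G fG hG] := @finite_witness _ A (setT : set 'I_n)
    (fun k G => malcev_step G (c k) (c k.+1)).
- exact: finite_finset.
- by move=> k G G' /malcev_step_le h; apply: h.
- have [t [tv /term_in_finite[G fG tG] /term_in_finite[G' fG' tG']]] := hc k (ltn_ord k).
  exists (G `|` G')%classic; first by rewrite finite_setU.
  by exists t; split=> //; [apply: term_in_le tG|apply: term_in_le tG'];
    [left|right].
exists G => //; exists n, c; split=> // k kn.
exact: (hG (Ordinal kn)).
Qed.

End Malcev.

(** * Quotient maps of semilattices and compact congruences *)

Section QuotientMaps.

Lemma semihom_le (S T : semilattice) (f : S -> T) :
  is_semihom f -> forall x y, x <= y -> f x <= f y.
Proof. by move=> [_ fU] x y /join_idPl xy; rewrite -xy fU leUr. Qed.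

Lemma semihom_joins (S T : semilattice) (f : S -> T) (fh : is_semihom f)
    n (F : 'I_n -> S) : f (\join_(i < n) F i) = \join_(i < n) f (F i).
Proof. exact: (big_morph f fh.2 fh.1). Qed.

Lemma semihom_joins_seq (S T : semilattice) (f : S -> T) (fh : is_semihom f)
    (X : seq S) : f (\join_(s <- X) s) = \join_(s <- X) f s.
Proof. exact: (big_morph f fh.2 fh.1). Qed.

Lemma semihom_comp (S T U : semilattice) (f : S -> T) (g : T -> U) :
  is_semihom f -> is_semihom g -> is_semihom (g \o f).
Proof.
move=> [f0 fU] [g0 gU]; split=> [|x y] /=; first by rewrite f0.
by rewrite fU gU.
Qed.

Definition bot_set (T : semilattice) (x : T) : Prop := x = \bot.

Lemma bot_ideal_lower (T : semilattice) (x y : T) : x <= y -> bot_set y -> bot_set x.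
Proof. by move=> xy y0; apply/eqP; rewrite -lex0 -y0. Qed.

Lemma bot_idealU (T : semilattice) (x y : T) :
  bot_set x -> bot_set y -> bot_set (x `|` y).
Proof. by move=> -> ->; rewrite /bot_set joinxx. Qed.

Definition bot_ideal (T : semilattice) : ideal T :=
  Ideal (erefl \bot) (@bot_ideal_lower T) (@bot_idealU T).

Section PreimIdeal.
Variables (S T : semilattice) (f : S -> T) (fh : is_semihom f) (J : ideal T).

Definition preim_set (x : S) : Prop := J (f x).

Lemma preim_ideal0 : preim_set \bot.
Proof. by rewrite /preim_set fh.1; apply: ideal0. Qed.

Lemma preim_ideal_lower x y : x <= y -> preim_set y -> preim_set x.
Proof. by move=> /(semihom_le fh); apply: ideal_lower. Qed.

Lemma preim_idealU x y : preim_set x -> preim_set y -> preim_set (x `|` y).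
Proof. by rewrite /preim_set fh.2; apply: idealU. Qed.

Definition preim_ideal : ideal S := Ideal preim_ideal0 preim_ideal_lower preim_idealU.

End PreimIdeal.

(* The maps that are, up to isomorphism, the projections [S -> S / I]. *)
Definition quotient_map (S T : semilattice) (f : S -> T) : Prop :=
  [/\ is_semihom f, forall t, exists s, f s = t
    & forall x y, f x <= f y -> exists2 u, f u = \bot & x <= y `|` u].

Lemma quotient_map_factor (S T U : semilattice) (f : S -> T) (g : S -> U) :
  quotient_map f -> is_semihom g -> (forall x, f x = \bot -> g x = \bot) ->
  forall x y, f x <= f y -> g x <= g y.
Proof.
move=> [_ _ fi] gh fg x y /fi[u /fg gu xy].
by have := semihom_le gh xy; rewrite gh.2 gu joinx0.
Qed.

(** By [quotient_map_factor], quotient maps with the same zeros induce the same preorder on [S], so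
    [g] after a section of [f] does not depend on the section. *)
Lemma quotient_map_iso (S T U : semilattice) (f : S -> T) (g : S -> U) :
  quotient_map f -> quotient_map g -> (forall x, f x = \bot <-> g x = \bot) ->
  exists h : T -> U, [/\ is_semihom h, bijective h & forall x, h (f x) = g x].
Proof.
move=> fq gq fg; have [fh fs _] := fq; have [gh gs _] := gq.
have fgle x y : f x <= f y <-> g x <= g y.
  split; first by apply: quotient_map_factor => // z /fg.
  by apply: quotient_map_factor => // z /fg.
have fgE x y : f x = f y <-> g x = g y.
  by split=> e; apply/le_anti/andP; split; apply/fgle; rewrite e.
have [s sE] := choice fs; have [r rE] := choice gs.
have hE x : g (s (f x)) = g x by apply/fgE.
have kE x : f (r (g x)) = f x by apply/fgE.
exists (g \o s); split=> //=.
- split=> [|t u]; first by rewrite /= -fh.1 hE gh.1.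
  by rewrite /= -{1}(sE t) -{1}(sE u) -fh.2 hE gh.2.
- exists (f \o r) => [t|u] /=; first by rewrite kE.
  by rewrite hE.
Qed.

Lemma semi_pi_quotient_map (S : semilattice) (I : ideal S) :
  quotient_map (semi_pi I : S -> semi_quot I).
Proof.
split; first exact: semi_pi_hom.
- by move=> X; have [x ->] := semi_pi_surj X; exists x.
- by move=> x y /semi_pi_le[u Iu xy]; exists u => //; apply/semi_pi_eq0.
Qed.

Lemma quotient_map_comp_iso (S T U : semilattice) (f : S -> T) (g : T -> U) :
  is_semihom f -> bijective f -> quotient_map g -> quotient_map (g \o f).
Proof.
move=> fh [k kf fk] [gh gs gi]; split; first exact: semihom_comp.
  by move=> u; have [t <-] := gs u; exists (k t) => /=; rewrite fk.
move=> x y /= /gi[u gu xy]; exists (k u); first by rewrite /= fk.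
by apply/join_idPl; apply: (can_inj kf); rewrite !fh.2 fk; apply/join_idPl.
Qed.

End QuotientMaps.

Section CompactCongruences.
Variables (L : signature).

Lemma conc_joins (A : algebra L) (al : conc A) :
  exists n (x y : 'I_n -> A), al = \join_(k < n) Theta (x k) (y k).
Proof.
have [X /finite_enum[n [e XE]] alE] := conc_fg al.
exists n, (fun k => (e k).1), (fun k => (e k).2).
apply/le_anti/andP; split.
  apply/conc_leP; rewrite alE; apply: cgen_sub; first exact: conc_cong.
  rewrite XE => _ [k _ <-]; case E : (e k) => [x y]; apply/Theta_le.
  have := joins_sup (fun k => Theta (e k).1 (e k).2) (isT : xpredT k).
  by rewrite E.
apply/joinsP => k _; apply/Theta_le; rewrite alE; apply: sub_cgen.
by rewrite XE; exists k => //; case: (e k).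
Qed.

Lemma conc_joins_set (A : algebra L) n (x y : 'I_n -> A) :
  conc_set (\join_(k < n) Theta (x k) (y k)) =
  cgen [set (x k, y k) | k in [set: 'I_n]].
Proof.
apply/seteqP; split.
  have fX : finite_set [set (x k, y k) | k in [set: 'I_n]].
    exact/finite_image/finite_finset.
  pose al : conc A := Conc (ex_intro2 _ _ _ fX erefl).
  suff /conc_leP : \join_(k < n) Theta (x k) (y k) <= al by [].
  by apply/joinsP => k _; apply/Theta_le; apply: sub_cgen; exists k.
apply: cgen_sub; first exact: conc_cong.
move=> _ [k _ <-]; apply/Theta_le.
exact: joins_sup (fun k => Theta (x k) (y k)) isT.
Qed.

Lemma conc_map_bot (A B : algebra L) (f : pa_hom A B) (al : conc A) :
  conc_map f al = \bot <-> forall x y, conc_set al (x, y) -> f x = f y.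
Proof.
split=> [e x y xy|h].
  apply/(conc0P (A := B)); rewrite -e; apply: sub_cgen.
  by exists (x, y).
apply/eqP; rewrite -lex0; apply/conc_leP; apply: cgen_sub; first exact: conc_cong.
by move=> _ [[x y] xy <-]; apply/conc0P; apply: h.
Qed.

(** Arities are finite, so the join of finitely many members of [D] that relate the arguments
    relates the values. *)
Lemma directed_union_cong (A : algebra L) (D : set (conc A)) :
  D \bot -> (forall x y, D x -> D y -> D (x `|` y)) ->
  is_congruence [set z | exists2 al, D al & conc_set al z].
Proof.
move=> D0 DU; split.
- by move=> x; exists \bot => //; apply: (cong_refl (conc_cong _)).
- by move=> x y [al Dal h]; exists al => //; apply: (cong_sym (conc_cong _)).
- move=> x y z [al Dal h] [be Dbe h']; exists (al `|` be); first exact: DU.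
  apply: (cong_trans (conc_cong _) (y := y)).
    by apply: (proj1 (conc_leP _ _) (leUl al be)).
  by apply: (proj1 (conc_leP _ _) (leUr be al)).
- move=> l x y a b xy xa yb.
  have {}xy i : exists be, D be /\ conc_set be (x i, y i).
    by have [be Dbe h] := xy i; exists be.
  have [al hal] := choice xy.
  have Dal : D (\join_(i < arity l) al i).
    by elim/big_ind: _ => // i _; have [] := hal i.
  exists (\join_(i < arity l) al i) => //; apply: (cong_op (conc_cong _)) xa yb => i.
  have [_ h] := hal i; apply: (proj1 (conc_leP _ _) _ _ h).
  exact: joins_sup al isT.
Qed.

Lemma conc_le_compact (A : algebra L) (D : set (conc A)) (al : conc A) :
  D \bot -> (forall x y, D x -> D y -> D (x `|` y)) ->
  (forall z, conc_set al z -> exists2 be, D be & conc_set be z) ->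
  exists2 be, D be & al <= be.
Proof.
move=> D0 DU alD; have [X fX alE] := conc_fg al.
have [||z Xz|[be Dbe] hbe] := @finite_directed _ {be | D be} X
  (fun z be => conc_set (sval be) z) fX.
- by split; exists \bot.
- move=> [be Dbe] [ga Dga]; exists (exist _ _ (DU _ _ Dbe Dga)) => z /= [] h.
    by apply: (proj1 (conc_leP _ _) (leUl be ga)).
  by apply: (proj1 (conc_leP _ _) (leUr ga be)).
- have [|be Dbe hbe] := alD z; first by rewrite alE; apply: sub_cgen.
  by exists (exist _ be Dbe).
- exists be => //; apply/conc_leP; rewrite alE.
  by apply: cgen_sub; [apply: conc_cong | apply: hbe].
Qed.

(** Suppose that the image of [al] lies below that of [be]. The joins of [be] with the compact
    congruences killed by [f] have as union a congruence [R] that contains the kernel of [f].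
    Transported to [B], it contains the image of [be], hence that of [al]; so [R] contains [al], and
    compactness of [al] selects a single join. *)
Lemma conc_map_quotient_map (A B : algebra L) (f : pa_hom A B) :
  (forall y, exists x, f x = y) -> quotient_map (conc_map f).
Proof.
move=> fs; have [s sE] := choice fs; split; first exact: conc_map_hom.
  move=> th; have [n [x [y ->]]] := conc_joins th.
  exists (\join_(k < n) Theta (s (x k)) (s (y k))).
  rewrite (semihom_joins (conc_map_hom f)); apply: eq_bigr => k _.
  by rewrite conc_map_Theta !sE.
move=> al be albe.
pose D := [set ga | exists2 io, conc_map f io = \bot & ga = be `|` io].
have fh := conc_map_hom f.
have DU x y : D x -> D y -> D (x `|` y).
  move=> [io i0 ->] [ka k0 ->]; exists (io `|` ka).
    by rewrite fh.2 i0 k0 joinxx.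
  by rewrite joinACA joinxx.
have Dbe : D be by exists \bot; [apply: fh.1 | rewrite joinx0].
(* The bottom is added because the lemmas on directed unions ask for it and it need not belong to
   [D]. *)
pose D' := [set ga | ga = \bot \/ D ga].
have D'U x y : D' x -> D' y -> D' (x `|` y).
  by move=> [->|Dx] [->|Dy]; rewrite ?joinx0 ?join0x; [left|right|right|right; apply: DU].
have D'0 : D' \bot by left.
pose R := [set z | exists2 ga, D' ga & conc_set ga z].
have Rc : is_congruence R := directed_union_cong D'0 D'U.
have kerR x y : f x = f y -> R (x, y).
  move=> fxy; exists (be `|` Theta x y).
    by right; exists (Theta x y); rewrite // conc_map_Theta fxy; apply/Theta0.
  by apply/Theta_le; apply: leUr.
pose K := [set z : B * B | R (s z.1, s z.2)].
have Kc : is_congruence K.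
  split=> /=.
  - by move=> x; apply: (cong_refl Rc).
  - by move=> x y; apply: (cong_sym Rc).
  - by move=> x y z; apply: (cong_trans Rc).
  - move=> l x y a b xy xa yb.
    have [a' xa'] := alg_total (s \o x); have [b' yb'] := alg_total (s \o y).
    (* The section [s] need not be a homomorphism, but it respects operations modulo the kernel of
       [f], which [R] contains. *)
    have fE (z : 'I_(arity l) -> B) c c' :
        pa_graph B l z c -> pa_graph A l (s \o z) c' -> f c' = f (s c).
      move=> zc zc'; rewrite sE; apply: pa_functional (pa_homP f zc') _.
      by rewrite (_ : f \o (s \o z) = z) //; apply/funext => i /=; rewrite sE.
    apply: (cong_trans Rc (y := a')); first exact/kerR/esym/(fE x).
    apply: (cong_trans Rc (y := b')); last exact/kerR/(fE y).
    exact: (cong_op Rc xy) xa' yb'.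
have beK : conc_set (conc_map f be) `<=` K.
  apply: cgen_sub => // _ [[x y] bexy <-] /=.
  apply: (cong_trans Rc (y := x)); first by apply: kerR; rewrite sE.
  apply: (cong_trans Rc (y := y)); last by apply: kerR; rewrite sE.
  by exists be => //; right.
have [[x y] alxy|ga D'ga alga] := @conc_le_compact _ D' al D'0 D'U.
  have /beK/= Kxy : conc_set (conc_map f be) (f x, f y).
    by apply: (proj1 (conc_leP _ _) albe); apply: sub_cgen; exists (x, y).
  have : R (x, y).
    apply: (cong_trans Rc (y := s (f x))); first by apply: kerR; rewrite sE.
    by apply: (cong_trans Rc (y := s (f y))) Kxy _; apply: kerR; rewrite sE.
  by move=> [ga D'ga h]; exists ga.
case: D'ga => [ga0|[io i0 gaE]].
  by exists \bot; [apply: fh.1 | rewrite joinx0 (le_trans alga) // ga0 le0x].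
by exists io => //; rewrite -gaE.
Qed.

End CompactCongruences.

(** * Quotients of an algebra and their sub-gamps *)

Section QuotientAlgebra.
Variables (L : signature) (B : algebra L) (I : ideal (pg_semi (gamp_of_alg B))).

Lemma quot_total l (X : 'I_(arity l) -> pgq_pa I) : pa_def X.
Proof.
have [y xy] := alg_total (fun i => Defs.repr (X i)).
exists (pgq_pi I y), (fun i => Defs.repr (X i)), y; split=> //.
by apply/funext => i /=; rewrite /pgq_pi Defs.reprK.
Qed.

Lemma quot_inhabited : inhabited (pgq_pa I).
Proof. by have [x] := alg_inhabited B; split; apply: (pgq_pi I x). Qed.

Definition quot_alg : algebra L := Algebra quot_total quot_inhabited.

Definition quot_proj : pa_hom B quot_alg := pgq_proj I.

Lemma quot_proj_surj (X : quot_alg) : exists x, quot_proj x = X.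
Proof. by have [x ->] := pgq_surj X; exists x. Qed.

Lemma quot_proj_eq x y : quot_proj x = quot_proj y <-> I (Theta x y).
Proof. exact: pgq_pi_eq. Qed.

Lemma quot_proj_repr (X : quot_alg) : quot_proj (Defs.repr X) = X.
Proof. exact: Defs.reprK. Qed.

End QuotientAlgebra.

Section SubGamps.
Variables (L : signature) (B : algebra L) (T : semilattice) (rho : conc B -> T).
Variable rq : quotient_map rho.

Let rh : is_semihom rho. Proof. by case: rq. Qed.

(** Typing the ideal over [gamp_of_alg B] lets the pregamp quotient serve as the quotient algebra of
    [B]. *)
Definition ker_ideal : ideal (pg_semi (gamp_of_alg B)) := preim_ideal rh (bot_ideal T).

Notation Q := (quot_alg ker_ideal).
Notation pi := (quot_proj ker_ideal).

(** A compact congruence is a join of principal ones, and on these both sides mean that [pi]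
    identifies the two generators. *)
Lemma ker_ideal_conc (al : conc B) : rho al = \bot <-> conc_map pi al = \bot.
Proof.
rewrite conc_map_bot; split=> [al0 x y /Theta_le alxy|].
  by apply/quot_proj_eq; apply: (ideal_lower (i := ker_ideal) alxy).
have [n [x [y ->]]] := conc_joins al => h.
apply: (@ideal_join _ (gamp_of_alg B) ker_ideal) => i.
by apply/quot_proj_eq; apply: h; apply/Theta_le; apply: joins_sup (fun k => Theta (x k) (y k)) isT.
Qed.

Lemma realizer_ex : exists h : T -> conc Q,
  [/\ is_semihom h, bijective h & forall al, h (rho al) = conc_map pi al].
Proof.
apply: quotient_map_iso => //; last exact: ker_ideal_conc.
exact/conc_map_quotient_map/quot_proj_surj.
Qed.

Definition realizer : T -> conc Q := projT1 (cid realizer_ex).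

Lemma realizer_hom : is_semihom realizer.
Proof. by rewrite /realizer; case: cid => h []. Qed.

Lemma realizer_bij : bijective realizer.
Proof. by rewrite /realizer; case: cid => h []. Qed.

Lemma realizer_rho al : realizer (rho al) = conc_map pi al.
Proof. by rewrite /realizer; case: cid => h []. Qed.

Lemma realizer_le s t : realizer s <= realizer t <-> s <= t.
Proof.
split=> [/join_idPl|]; last exact: semihom_le realizer_hom _ _.
by rewrite -realizer_hom.2 => /(bij_inj realizer_bij) st; apply/join_idPl.
Qed.

(** Values are taken in [T], not in [conc Q], so that the semilattice of the gamp is the prescribed
    one; [realizer] translates between the two. *)
Definition qdist (X Y : Q) : T := rho (Theta (Defs.repr X) (Defs.repr Y)).

Lemma realizer_qdist X Y : realizer (qdist X Y) = Theta X Y.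
Proof. by rewrite realizer_rho conc_map_Theta !quot_proj_repr. Qed.

Lemma qdistE x y : qdist (pi x) (pi y) = rho (Theta x y).
Proof.
by apply: (bij_inj realizer_bij); rewrite realizer_qdist realizer_rho conc_map_Theta.
Qed.

Lemma qdist_le X Y s : qdist X Y <= s <-> conc_set (realizer s) (X, Y).
Proof. by rewrite -realizer_le realizer_qdist; apply: Theta_le. Qed.

Section SubGamp.
Variables G Gs : set Q.

(** This is the largest partial structure on [G]: an operation is defined as soon as its value stays
    in [G]. *)
Definition sub_graph (l : symbol L) (x : 'I_(arity l) -> {X | G X}) (y : {X | G X}) :=
  pa_graph Q l (fun i => sval (x i)) (sval y).

Lemma sval_inj (x y : {X | G X}) : sval x = sval y -> x = y.
Proof. by case: x y => [x hx] [y hy] /= xy; apply: eq_exist. Qed.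

Lemma sub_functional l (x : 'I_(arity l) -> {X | G X}) y z :
  sub_graph x y -> sub_graph x z -> y = z.
Proof. by move=> xy xz; apply: sval_inj; apply: pa_functional xy xz. Qed.

Definition sub_pa : partial_algebra L := PartialAlgebra sub_functional.

Definition sub_incl : pa_hom sub_pa Q :=
  @PaHom L sub_pa Q (@sval _ _) (fun l x y (xy : pa_graph sub_pa l x y) => xy).

Definition sub_dist (x y : sub_pa) : T := qdist (sval x) (sval y).

Lemma sub_dist0 x y : sub_dist x y = \bot <-> x = y.
Proof.
split=> [|->]; last first.
  by apply: (bij_inj realizer_bij); rewrite realizer_qdist realizer_hom.1; apply/Theta0.
move/(congr1 realizer); rewrite realizer_qdist realizer_hom.1 => /Theta0.
exact: sval_inj.
Qed.

Lemma sub_dist_sym x y : sub_dist x y = sub_dist y x.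
Proof. by apply: (bij_inj realizer_bij); rewrite !realizer_qdist Theta_sym. Qed.

Lemma sub_dist_tri x y z : sub_dist x y <= sub_dist x z `|` sub_dist z y.
Proof.
apply/realizer_le; rewrite realizer_hom.2 !realizer_qdist; exact: Theta_tri.
Qed.

Lemma sub_dist_op l x y a b : pa_graph sub_pa l x a -> pa_graph sub_pa l y b ->
  sub_dist a b <= \join_(k < arity l) sub_dist (x k) (y k).
Proof.
move=> xa yb; apply/realizer_le.
rewrite (semihom_joins realizer_hom) realizer_qdist.
under eq_bigr do rewrite realizer_qdist.
exact: Theta_op xa yb.
Qed.

Definition sub_pregamp : pregamp L :=
  Pregamp sub_dist0 sub_dist_sym sub_dist_tri sub_dist_op.

Definition sub_star_set (x : sub_pa) : Prop := Gs (sval x).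

Definition sub_star_graph l (x : 'I_(arity l) -> sub_pa) (y : sub_pa) : Prop :=
  [/\ forall i, sub_star_set (x i), sub_star_set y & pa_graph sub_pa l x y].

Definition sub_gamp : gamp L :=
  @Gamp L sub_pregamp (@PSub L sub_pa sub_star_set sub_star_graph (fun l x y h => h)).

End SubGamp.

Section Variety.
Variables (W : algebra L -> Prop) (Wv : is_variety W) (WB : W B).

Lemma quot_alg_variety (I : ideal (pg_semi (gamp_of_alg B))) : W (quot_alg I).
Proof. exact: variety_surj Wv (@quot_proj_surj L B I) WB. Qed.

(** The quotient by [J] embeds into the quotient of [B] by the preimage of [J], an algebra of [W];
    identities pass back along a one-to-one morphism. *)
Lemma sub_gamp_of G Gs : gamp_of W (sub_gamp G Gs).
Proof.
move=> J e We; pose QJ := quot_alg (preim_ideal rh J : ideal (pg_semi (gamp_of_alg B))).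
pose piJ : pa_hom B QJ := quot_proj _.
pose f (X : pregamp_quot J) : QJ := piJ (Defs.repr (sval (Defs.repr X))).
have fE x : f (pgq_pi J x) = piJ (Defs.repr (sval x)).
  apply/quot_proj_eq; rewrite /= /preim_set.
  exact: (proj1 (pgq_pi_eq J _ _) (Defs.reprK _)).
have fhom l x y : pa_graph (pregamp_quot J) l x y -> pa_graph QJ l (f \o x) (f y).
  move=> [x' [y' [xy -> ->]]].
  have [z xz] := alg_total (fun i => Defs.repr (sval (x' i))).
  have -> : f (pgq_pi J y') = piJ z.
    rewrite fE; apply/quot_proj_eq; rewrite /= /preim_set.
    have /quot_proj_eq/= e0 : pi (Defs.repr (sval y')) = pi z.
      have xyQ : pa_graph Q l (fun i => sval (x' i)) (sval y') := xy.
      rewrite quot_proj_repr; apply: pa_functional xyQ _.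
      rewrite (_ : (fun i => _) = pi \o (fun i => Defs.repr (sval (x' i)))).
        exact: pa_homP.
      by apply/funext => i; rewrite /= [RHS]quot_proj_repr.
    by rewrite e0; apply: ideal0.
  rewrite (_ : f \o _ = piJ \o (fun i => Defs.repr (sval (x' i)))).
    exact: pa_homP.
  by apply/funext => i; apply: fE.
apply: (satisfies_inj (f := PaHom fhom)); last first.
  by apply: We; apply: quot_alg_variety.
move=> X Y; have [x ->] := pgq_surj X; have [y ->] := pgq_surj Y.
rewrite [_ (pgq_pi J x)]fE [_ (pgq_pi J y)]fE => /quot_proj_eq h.
exact/pgq_pi_eq.
Qed.

Lemma sub_gamp_realization G Gs : has_iso_realization W (sub_gamp G Gs).
Proof.
exists Q, (sub_incl G), realizer; split; last exact: realizer_bij.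
split; [exact: quot_alg_variety | exact: sval_inj | exact: realizer_hom | |].
- exact: bij_inj realizer_bij.
- by move=> x y; apply: realizer_qdist.
Qed.

End Variety.

End SubGamps.

(** * Subsets of a quotient algebra that carry suitable gamps *)

Section TermRestriction.
Variables (L : signature) (A : partial_algebra L) (G : set A).

Lemma term_in_vars X (v : X -> A) t a : term_in G v t a -> term_vars (v @^-1` G) t.
Proof.
elim: t a => [x|l ts IH] a /=; first by move=> [Ga <-].
by move=> [_ [b [hb _]]] i; apply: IH (hb i).
Qed.

Lemma term_varsI X (D D' : set X) (t : term L X) :
  term_vars D t -> term_vars D' t -> term_vars (D `&` D')%classic t.
Proof. by elim: t => [x|l ts IH] //= h h' i; apply: IH. Qed.

End TermRestriction.

Definition with_values (L : signature) (A : partial_algebra L) (C : set A) : set A :=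
  C `|` [set y | exists l (x : 'I_(arity l) -> A), (forall i, C (x i)) /\ pa_graph A l x y].

(** Finitely many symbols each have finitely many argument tuples in [C]; here the finiteness of the
    similarity type enters. *)
Lemma with_values_finite (L : signature) (L_finite : finite_set [set: symbol L])
    (A : algebra L) (C : set A) : finite_set C -> finite_set (with_values C).
Proof.
move=> fC; rewrite finite_setU; split=> //.
pose op l (x : 'I_(arity l) -> A) := projT1 (cid (alg_total x)).
have := bigcup_finite L_finite (fun l _ =>
  finite_image (@op l) (finite_families (arity l) fC)).
apply: sub_finite_set => y [l [x [Cx xy]]]; exists l => //; exists x => //.
by rewrite /op; case: cid => z /= xz; apply: pa_functional xz xy.
Qed.

Section Good.
Variables (L : signature) (B : algebra L) (T : semilattice) (rho : conc B -> T).
Variable rq : quotient_map rho.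

Notation Q := (quot_alg (ker_ideal rq)).
Notation qdist := (@qdist L B T rho rq).

Lemma term_val_sub (G : set Q) X (v : X -> sub_pa G) t a :
  term_in G (fun x => sval (v x)) t a -> exists2 a', sval a' = a & term_val v t a'.
Proof.
elim: t a => [x|l ts IH] a /= [Ga]; first by move=> ->; exists (v x).
move=> [b [hb ba]]; exists (exist _ a Ga) => //.
have IH' i : exists c, sval c = b i /\ term_val v (ts i) c.
  by have [c cE hc] := IH i _ (hb i); exists c.
have [c hc] := choice IH'; exists c; split=> [i|]; first by have [] := hc i.
rewrite /= /sub_graph (_ : (fun i => _) = b) //.
by apply/funext => i; have [] := hc i.
Qed.

Definition generated (G : set Q) (s : T) : Prop :=
  exists n (x y : 'I_n -> Q), (forall k, G (x k) /\ G (y k)) /\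
    s = \join_(k < n) qdist (x k) (y k).

Definition cut_step (D : set T) (G : set Q) (x y : Q) : Prop :=
  [/\ G x, G y & exists2 s, D s & qdist x y <= s].

(* Sufficient conditions for [sub_gamp G Gs] to satisfy the clauses
   of a partial lifting; [F] contains the images of the incoming morphisms, whose
   elements have to be connected by chains in [Gs]. *)
Record good (F Gs G : set Q) : Prop := Good {
  good_F : F `<=` Gs;
  good_sub : Gs `<=` G;
  good_ops : forall l (x : 'I_(arity l) -> Q) y,
    (forall i, Gs (x i)) -> pa_graph Q l x y -> G y;
  good_generated : forall s, generated Gs s;
  good_malcev : forall x y (S : set (Q * Q)), Gs x -> Gs y ->
    (forall z, S z -> Gs z.1 /\ Gs z.2) ->
    cgen S (x, y) -> chain (malcev_step S G) x y;
  good_cut : forall (X : seq T) x y, F x -> F y ->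
    qdist x y <= \join_(s <- X) s -> chain (cut_step [set` X] Gs) x y }.

Lemma generated_le G G' s : G `<=` G' -> generated G s -> generated G' s.
Proof.
move=> GG' [n [x [y [h ->]]]]; exists n, x, y; split=> // k.
by have [/GG' ? /GG' ?] := h k.
Qed.

Lemma generated_finite s : exists2 G, finite_set G & generated G s.
Proof.
have [rh rs _] := rq; have [al <-] := rs s.
have [n [x [y ->]]] := conc_joins al; pose pi := quot_proj (ker_ideal rq).
exists (range (pi \o x) `|` range (pi \o y))%classic.
  by rewrite finite_setU; split; apply/finite_image/finite_finset.
exists n, (pi \o x), (pi \o y); split=> [k|].
  by split; [left | right]; exists k.
by rewrite (semihom_joins rh); apply: eq_bigr => k _; rewrite qdistE.
Qed.

Lemma cut_step_le D G G' x y : G `<=` G' -> cut_step D G x y -> cut_step D G' x y.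
Proof. by move=> GG' [/GG' ? /GG' ? h]. Qed.

(* For each [s], the relation [qdist a b <= s] is a congruence, hence the chains
   form one too. *)
Lemma cut_finite (X : seq T) x y : qdist x y <= \join_(s <- X) s ->
  exists2 G, finite_set G & chain (cut_step [set` X] G) x y.
Proof.
pose R a b := exists2 s, s \in X & qdist a b <= s.
move=> xyX; suff /(@chain_finite _ R)[G fG h] : chain R x y by exists G.
have Rc : is_congruence [set z | chain R z.1 z.2].
  apply: chain_congruence => [a b [s Xs ab]|l i z a b u v [s Xs ab] ua vb]; exists s => //.
    by apply/qdist_le; apply: (cong_sym (conc_cong _)); apply/qdist_le.
  apply/qdist_le; apply: (cong_op (conc_cong _)) ua vb => k.
  rewrite /upd; case: ifP => _; last exact: (cong_refl (conc_cong _)).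
  exact/qdist_le.
move/qdist_le: xyX; rewrite (semihom_joins_seq (realizer_hom rq)).
have RX s : s \in X -> conc_set (realizer rq s) `<=` [set z | chain R z.1 z.2].
  by move=> Xs [a b] /qdist_le ab; apply: chain1; exists s.
have : conc_set (\join_(s <- X) realizer rq s) `<=` [set z | chain R z.1 z.2].
  rewrite big_seq; elim/big_ind: _ => [|al be alR beR|//].
    by apply: cgen_sub => // z [].
  by apply: cgen_sub => // z [/alR|/beR].
by apply.
Qed.

(** Tractability concerns lists of pairs of any length, but Mal'cev chains depend only on the set of
    pairs, and such sets are finite in number. *)
Lemma malcev_index_finite (Gs : set Q) : finite_set Gs ->
  finite_set [set S : set (Q * Q) | forall z, S z -> Gs z.1 /\ Gs z.2].
Proof.
move=> fGs; apply: sub_finite_set (finite_subsets (finite_setX fGs fGs)).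
by move=> S SG z /SG[].
Qed.

(** This is the case of a maximal index, where nothing has to be finite. *)
Lemma good_setT F : good F setT setT.
Proof.
split=> //.
- by move=> s; have [G _ sG] := generated_finite s; apply: generated_le sG.
- move=> x y S _ _ _ /malcev_chain[G _]; apply: chain_le => a b.
  exact: malcev_step_le.
- move=> X x y _ _ /cut_finite[G _]; apply: chain_le => a b.
  exact: cut_step_le.
Qed.

(** The order of choice avoids circularity: generators of [T] and cutting chains for [F] enter [Gs],
    while Mal'cev witnesses for [Gs] and values of operations enter only [G]. *)
Lemma good_exists (L_finite : finite_set [set: symbol L])
    (T_finite : finite_set [set: T]) F : finite_set F ->
  exists Gs G, [/\ finite_set Gs, finite_set G & good F Gs G].
Proof.
move=> fF.
have [|G1 fG1 hG1] := finite_witness T_finite (P := fun s G => generated G s) _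
  (fun s _ => generated_finite s).
  by move=> s G G'; apply: generated_le.
(* There are infinitely many lists over [T], but a cutting chain depends only on the set of entries,
   so finitely many requirements remain. *)
have [|||G2 fG2 hG2] := @finite_witness (Q * Q * set T) Q
    ((F `*` F) `*` [set D | D `<=` setT])%classic
    (fun z G => forall X : seq T, [set` X] = z.2 -> qdist z.1.1 z.1.2 <= \join_(s <- X) s ->
      chain (cut_step z.2 G) z.1.1 z.1.2).
- by apply: finite_setX; [apply: finite_setX | apply: finite_subsets].
- move=> z G G' GG' h X XE /(h X XE); apply: chain_le => a b.
  exact: cut_step_le.
- move=> [[x y] D] /= _.
  have [[X [XD]]|h] := pselect (exists X : seq T, [set` X] = D /\
    qdist x y <= \join_(s <- X) s); last first.
    by exists set0 => // X XE XD; case: h; exists X.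
  by move=> /cut_finite[G fG hG]; exists G => // X' _ _; rewrite -XD.
pose Gs := (F `|` (G1 `|` G2))%classic.
have fGs : finite_set Gs by rewrite !finite_setU.
have [|||G3 fG3 hG3] := @finite_witness (Q * Q * set (Q * Q)) Q
    ((Gs `*` Gs) `*` [set S | forall z, S z -> Gs z.1 /\ Gs z.2])%classic
    (fun z G => cgen z.2 z.1 -> chain (malcev_step z.2 G) z.1.1 z.1.2).
- by apply: finite_setX; [apply: finite_setX | apply: malcev_index_finite].
- move=> z G G' GG' h /h; apply: chain_le => a b.
  exact: malcev_step_le.
- move=> [[x y] S] /= _; have [/malcev_chain[G fG hG]|h] := pselect (cgen S (x, y)).
    by exists G.
  by exists set0.
exists Gs, (with_values Gs `|` G3)%classic; split=> //.
  by rewrite finite_setU; split=> //; apply: with_values_finite.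
split.
- by move=> x; left.
- by move=> x; left; left.
- by move=> l x y Gx xy; left; right; exists l, x.
- by move=> s; apply: generated_le (hG1 s I) => x G1x; right; left.
- move=> x y S Gx Gy SG xyS; have /= := hG3 (x, y, S) _ xyS.
  move=> /(_ (conj (conj Gx Gy) SG)); apply: chain_le => a b.
  by apply: malcev_step_le => z; right.
- move=> X x y Fx Fy xyX; have /= := hG2 (x, y, [set` X]) _ X erefl xyX.
  move=> /(_ (conj (conj Fx Fy) (fun _ _ => I))); apply: chain_le => a b.
  by apply: cut_step_le => z; right; right.
Qed.

Section GoodGamp.
Variables (F Gs G : set Q) (FG : good F Gs G).

Lemma good_gamp_strong : gamp_strong (sub_gamp G Gs).
Proof.
split; first by split=> // l x y [].
move=> l x Gx; have [y xy] := alg_total (fun i => sval (x i)).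
by exists (exist _ y (good_ops FG Gx xy)).
Qed.

Lemma good_distance_generated : distance_generated (sub_gamp G Gs).
Proof.
move=> s; have [n [x [y [Gxy ->]]]] := good_generated FG s.
exists n, (fun k => exist _ (x k) (good_sub FG (Gxy k).1)).
by exists (fun k => exist _ (y k) (good_sub FG (Gxy k).2)).
Qed.

(** The chain from [good_malcev] uses pairs and elements of [G] as variables. Only finitely many
    occur, so they can be renamed by positions in [xs], [ys] and a finite list [zs]. *)
Lemma good_congruence_tractable : congruence_tractable (sub_gamp G Gs).
Proof.
move=> x y m xs ys Gx Gy Gxys xyD.
pose S := [set (sval (xs k), sval (ys k)) | k in [set: 'I_m]].
have {xyD} xyS : cgen S (sval x, sval y).
  rewrite -conc_joins_set; apply/Theta_le; rewrite -realizer_qdist.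
  under eq_bigr do rewrite -realizer_qdist.
  rewrite -(semihom_joins (realizer_hom rq)); exact/realizer_le.
have [|n [c [c0 cn hc]]] := good_malcev FG Gx Gy _ xyS.
  by move=> _ [k _ <-] /=; apply: Gxys.
have [t ht] : {t : 'I_n -> term L (Q * Q + Q) & forall k : 'I_n,
    [/\ term_vars (malcev_var S) (t k), term_in G (@fst_val L _) (t k) (c k)
      & term_in G (@snd_val L _) (t k) (c k.+1)]}.
  have h (k : 'I_n) := hc k (ltn_ord k).
  by have [t ht] := choice h; exists t.
pose D := (malcev_var S `&` (@fst_val L _ @^-1` G))%classic.
have tD k : term_vars D (t k).
  by have [tS /term_in_vars tG _] := ht k; apply: term_varsI.
have [|||E fE tE] := @finite_witness 'I_n (Q * Q + Q) setT
    (fun k E => term_vars (D `&` E)%classic (t k)).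
- exact: finite_finset.
- by move=> k E E' EE'; apply: term_vars_le => z [? /EE'].
- by move=> k _; apply: term_vars_finite.
(* Besides the parameters that occur, [y] is listed, so that a constant term with value [y] is
   available. *)
pose Pm := ([set sval y] `|` ([set q | E (inr q)] `&` G))%classic.
have fPm : finite_set Pm.
  rewrite finite_setU; split; first exact: finite_set1.
  apply: sub_finite_set (finite_image (@snd_val L Q) fE).
  by move=> q [Eq _]; exists (inr q).
have [r [e PmE]] := finite_enum fPm.
have Pme j : Pm (e j) by rewrite PmE; exists j.
have Ge j : G (e j) by have [->|[]] := Pme j => //; apply: (svalP y).
pose zs j : sub_pa G := exist _ (e j) (Ge j).
pose g (v : 'I_m + 'I_m + 'I_r) : Q * Q + Q := match v with
  | inl (inl k) => inl (sval (xs k), sval (ys k))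
  | inl (inr k) => inl (sval (ys k), sval (xs k))
  | inr j => inr (e j) end.
have gfst : @fst_val L Q \o g = (fun v => sval (val3 xs ys zs v)).
  by apply/funext => -[[k|k]|j].
have gsnd : @snd_val L Q \o g = (fun v => sval (val3 ys xs zs v)).
  by apply/funext => -[[k|k]|j].
have Dg q : (D `&` E)%classic q -> range g q.
  case: q => [[a b]|q] /= [[Sq Gq] Eq].
    case: Sq => -[k _ [<- <-]]; first by exists (inl (inl k)).
    by exists (inl (inr k)).
  have : Pm q by right.
  by rewrite PmE => -[j _ <-]; exists (inr j).
have [t' t'E] := choice (fun k => term_vars_range (term_vars_le Dg (tE k I))).
have [jy _ ejy] : range e (sval y) by rewrite -PmE; left.
(* A chain of length [n] has only [n] terms; from index [n] on, the constant [y] continues the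
   sequence. *)
pose u k := if insub k is Some k' then t' k' else Var (inr jy).
have uE k (kn : (k < n)%N) : u k = t' (Ordinal kn) by rewrite /u insubT.
have uN k : (n <= k)%N -> u k = Var (inr jy).
  by move=> nk; rewrite /u insubF // ltnNge nk.
have yE : y = zs jy by apply: sval_inj; rewrite /= ejy.
have vfst k (kn : (k < n)%N) :
    exists2 a, sval a = c k & term_val (val3 xs ys zs) (u k) a.
  apply: term_val_sub; have [_ + _] := ht (Ordinal kn).
  by rewrite uE t'E => /term_in_map; rewrite gfst.
have vsnd k (kn : (k < n)%N) :
    exists2 a, sval a = c k.+1 & term_val (val3 ys xs zs) (u k) a.
  apply: term_val_sub; have [_ _] := ht (Ordinal kn).
  by rewrite uE t'E => /term_in_map; rewrite gsnd.
(* The length [n.+1] is positive even if the chain is empty. *)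
exists n.+1, r, zs, u; split=> //.
- case: (posnP n) => [n0|n0].
    rewrite uN ?n0 //= -yE; apply: sval_inj.
    by rewrite -c0 -cn n0.
  have [a aE ha] := vfst 0%N n0; rewrite (_ : x = a) //.
  by apply: sval_inj; rewrite aE.
- by rewrite uN //= -yE.
move=> k; rewrite ltnS leq_eqVlt => /orP[/eqP->|kn].
  by exists y; rewrite !uN //= -yE.
have [a aE ha] := vsnd k kn; exists a; split=> //.
have [kn'|nk] := ltnP k.+1 n.
  have [b bE hb] := vfst _ kn'; rewrite (_ : a = b) //.
  by apply: sval_inj; rewrite aE bE.
rewrite uN //= -yE; apply: sval_inj; rewrite aE -cn.
by congr c; apply/eqP; rewrite eqn_leq nk kn.
Qed.

End GoodGamp.

End Good.

(** * Morphisms of sub-gamps and diagrams *)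

Section GampMorphism.
Variables (L : signature) (B : algebra L) (T U : semilattice).
Variables (rho : conc B -> T) (rq : quotient_map rho).
Variables (tau : conc B -> U) (tq : quotient_map tau).
Variables (phi : T -> U) (phih : is_semihom phi).
Variables Cs C Ds D : set B.
Hypotheses (CsC : Cs `<=` C) (CD : C `<=` D) (CsDs : Cs `<=` Ds).
Hypothesis compat : forall a b, with_values C a -> with_values C b ->
  tau (Theta a b) = phi (rho (Theta a b)).

Notation pi := (quot_proj (ker_ideal rq)).
Notation ti := (quot_proj (ker_ideal tq)).
Notation GC := (sub_gamp (rq := rq) (pi @` C) (pi @` Cs)).
Notation GD := (sub_gamp (rq := tq) (ti @` D) (ti @` Ds)).

Lemma compat_eq a b : with_values C a -> with_values C b -> pi a = pi b -> ti a = ti b.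
Proof.
move=> Ca Cb /quot_proj_eq/= e; apply/quot_proj_eq => /=.
by rewrite /preim_set /= /bot_set (compat Ca Cb) (e : rho _ = _) phih.1.
Qed.

Lemma rep_ex (z : GC) : exists c, C c /\ pi c = sval z.
Proof. by have [c Cc cz] := svalP z; exists c. Qed.

Definition rep (z : GC) : B := projT1 (cid (rep_ex z)).

Lemma repP z : C (rep z) /\ pi (rep z) = sval z.
Proof. by rewrite /rep; case: cid. Qed.

Lemma mor_subproof z : (ti @` D) (ti (rep z)).
Proof. by have [Cr _] := repP z; exists (rep z) => //; apply: CD. Qed.

Definition mor_fun (z : GC) : GD := exist _ (ti (rep z)) (mor_subproof z).

Lemma mor_funE z c : C c -> sval z = pi c -> sval (mor_fun z) = ti c.
Proof.
move=> Cc zc; have [Cr rz] := repP z.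
by apply: compat_eq; [left | left | rewrite rz].
Qed.

(** The operation applied to representatives in [C] gives an element of [with_values C] that may
    differ from the representative of [y]; hence [compat] has to cover [with_values C]. *)
Lemma mor_fun_hom l x y : pa_graph GC l x y -> pa_graph GD l (mor_fun \o x) (mor_fun y).
Proof.
move=> xy; have [a xa] := alg_total (rep \o x).
have [Cy yE] := repP y.
have ya : pi (rep y) = pi a.
  rewrite yE; apply: (@pa_functional L (quot_alg (ker_ideal rq)) _ _ _ _ xy).
  rewrite (_ : (fun i => _) = pi \o (rep \o x)); first exact: pa_homP.
  by apply/funext => i; have [_ <-] := repP (x i).
have -> : pa_graph GD l (mor_fun \o x) (mor_fun y) =
    pa_graph (quot_alg (ker_ideal tq)) l (ti \o (rep \o x)) (ti (rep y)) by [].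
rewrite (@compat_eq (rep y) a) //; first exact: pa_homP.
  by left.
by right; exists l, (rep \o x); split=> // i; have [] := repP (x i).
Qed.

Definition mor_pa_hom : pa_hom GC GD := PaHom mor_fun_hom.

Lemma mor_dist x y : pg_dist (mor_pa_hom x) (mor_pa_hom y) = phi (pg_dist x y).
Proof.
have [Cx xE] := repP x; have [Cy yE] := repP y.
rewrite /= /sub_dist /= -xE -yE !qdistE compat //; by left.
Qed.

Lemma mor_star : psub_le (psub_image mor_pa_hom (gp_star GC)) (gp_star GD).
Proof.
have h z : gp_star GC z -> gp_star GD (mor_pa_hom z).
  move=> [c Csc cz]; exists c; first exact: CsDs.
  exact: esym (mor_funE (CsC Csc) (esym cz)).
split=> [_ [z zs <-]|l _ _ [x [y [[xs ys xy] -> ->]]]]; first exact: h.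
by split=> [i||]; [apply: h (xs i) | apply: h ys | apply: pa_homP xy].
Qed.

Definition mor : gamp_hom GC GD := @GampHom L GC GD mor_pa_hom phi phih mor_dist mor_star.

Lemma morE z c : C c -> sval z = pi c -> sval (mor z) = ti c.
Proof. exact: mor_funE. Qed.

Lemma mor_strong : with_values C `<=` Ds -> Ds `<=` D -> gamp_hom_strong mor.
Proof.
move=> CDs DsD.
have h z : gp_star GD (mor z).
  by have [Cr _] := repP z; exists (rep z) => //; apply: CDs; left.
split; first split.
- by move=> _ [z _ <-]; apply: h.
- move=> l _ _ [x [y [xy -> ->]]].
  by split=> [i||]; [apply: h | apply: h | apply: pa_homP].
move=> l x xm; have [c cE] : {c : 'I_(arity l) -> B &
    forall i, C (c i) /\ sval (x i) = ti (c i)}.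
  have hx i : exists c, C c /\ sval (x i) = ti c.
    by have [z _ <-] := xm i; have [Cr _] := repP z; exists (rep z).
  by have [c hc] := choice hx; exists c.
have [a ca] := alg_total c.
have Dsa : Ds a by apply: CDs; right; exists l, c; split=> // i; have [] := cE i.
have tia : (ti @` D) (ti a) by exists a => //; apply: DsD.
exists (exist _ (ti a) tia); split.
- by move=> i; have [z _ <-] := xm i; apply: h.
- by exists a.
- rewrite /= /sub_graph /= (_ : (fun i => _) = ti \o c); first exact: (pa_homP ti ca).
  by apply/funext => i; have [] := cE i.
Qed.

Lemma mor_cuttable F : gamp_hom_strong mor ->
  good (ti @` F) (ti @` Ds) (ti @` D) -> C `<=` F -> congruence_cuttable mor.
Proof.
move=> [ms _] FG CF; split=> // X x y xyX.
have hF z : (ti @` F) (sval (mor z)).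
  by have [Cr _] := repP z; exists (rep z) => //; apply: CF.
have [n [c [c0 cn hc]]] := good_cut FG (hF x) (hF y) xyX.
have cG k : exists z : GD, (k <= n)%N -> (ti @` Ds) (c k) /\ sval z = c k.
  have [kn|_] := leqP k n; last by exists (mor x).
  (* Vertices before the last are covered by their outgoing step; the last one, also when [n] is
     zero, is an image of an element of [F]. *)
  have Gk : (ti @` Ds) (c k).
    move: kn; rewrite leq_eqVlt => /orP[/eqP->|/hc[]//].
    rewrite cn; apply: good_F FG _ _; exact: hF.
  by exists (exist _ (c k) (good_sub FG Gk)).
have [z zE] := choice cG; exists n, z; split.
- by apply: sval_inj; have [_ ->] := zE 0%N isT.
- by apply: sval_inj; have [_ ->] := zE n (leqnn n).
- by move=> k kn; have [Gk ze] := zE k kn; rewrite /= /sub_star_set ze.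
move=> k kn; have [_ _ [s Xs h]] := hc k kn; exists s => //.
by rewrite /= /sub_dist; have [_ ->] := zE k (ltnW kn); have [_ ->] := zE k.+1 kn.
Qed.

End GampMorphism.

Section FullSubGamp.
Variables (L : signature) (B : algebra L) (T : semilattice).
Variables (rho : conc B -> T) (rq : quotient_map rho).
Notation Q := (quot_alg (ker_ideal rq)).

(** The carriers agree up to trivial membership proofs; the semilattices are two quotients of
    [conc B] with the same zeros, so [quotient_map_iso] identifies them. *)
Lemma full_sub_gamp_quot (G Gs : set Q) : (forall z, G z) -> (forall z, Gs z) ->
  gamp_isomorphic (sub_gamp G Gs) (gamp_quot (A := gamp_of_alg B) (ker_ideal rq)).
Proof.
move=> GT GsT; pose I := ker_ideal rq.
have rhoI al : rho al = \bot <-> (semi_pi I al : semi_quot I) = \bot.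
  by rewrite semi_pi_eq0.
have [h [hh [k hk kh] hE]] := quotient_map_iso rq (semi_pi_quotient_map I) rhoI.
have kE al : k (semi_pi I al) = rho al by rewrite -hE hk.
have kh' : is_semihom k.
  split; first by rewrite -hh.1 hk.
  by move=> s t; rewrite -{1}(kh s) -{1}(kh t) -hh.2 hk.
pose A1 := sub_gamp G Gs; pose A2 := gamp_quot (A := gamp_of_alg B) I.
pose f : pa_hom A1 A2 := sub_incl G.
have ghom l x y : pa_graph A2 l x y ->
    pa_graph A1 l ((fun z => exist G z (GT z)) \o x) (exist G y (GT y)) by [].
pose g : pa_hom A2 A1 := PaHom ghom.
have fd x y : pg_dist (f x) (f y) = h (pg_dist x y) by exact: esym (hE _).
have gd x y : pg_dist (g x) (g y) = k (pg_dist x y) by exact: esym (kE _).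
have fs : psub_le (psub_image f (gp_star A1)) (gp_star A2).
  split=> [z _|l _ _ [x [y [[_ _ xy] -> ->]]]]; last by have [x' [y' h']] := xy; exists x', y'.
  by have [b bz] := quot_proj_surj z; exists b.
have gs : psub_le (psub_image g (gp_star A2)) (gp_star A1).
  split=> [z _|l _ _ [x [y [[x' [y' [xy -> ->]]] -> ->]]]]; first exact: GsT.
  by split=> [i||]; [exact: GsT | exact: GsT | exists x', y'].
exists (@GampHom L A1 A2 f h hh fd fs), (@GampHom L A2 A1 g k kh' gd gs); split=> //.
by move=> z; apply: sval_inj.
Qed.

End FullSubGamp.

Section Assembly.
Variables (L : signature) (W : algebra L -> Prop) (Wv : is_variety W).
Variables (B : algebra L) (WB : W B) (d : Order.disp_t) (P : porderType d).
Variables (S : semi_diagram P) (rho : forall p, conc B -> S p).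
Variables (rq : forall p, quotient_map (@rho p)) (F Cs C : P -> set B).

Notation pi p := (quot_proj (ker_ideal (rq p))).

Hypothesis goodC : forall p, good (pi p @` F p) (pi p @` Cs p) (pi p @` C p).
Hypothesis CsC : forall p, Cs p `<=` C p.
Hypothesis C_le : forall p q, p <= q -> C p `<=` C q.
Hypothesis Cs_le : forall p q, p <= q -> Cs p `<=` Cs q.
Hypothesis C_lt : forall p q, p < q -> with_values (C p) `<=` Cs q.
Hypothesis C_F : forall p q, p < q -> C p `<=` F q.
Hypothesis compat : forall p q (pq : p <= q) a b,
  with_values (C p) a -> with_values (C p) b ->
  rho q (Theta a b) = sd_mor pq (rho p (Theta a b)).

Definition lift_ob p : gamp L := sub_gamp (rq := rq p) (pi p @` C p) (pi p @` Cs p).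

Definition lift_mor p q (pq : p <= q) : gamp_hom (lift_ob p) (lift_ob q) :=
  mor (rq p) (rq q) (sd_hom S pq) (@CsC p) (@C_le p q pq)
    (@Cs_le p q pq) (@compat p q pq).

Lemma lift_morE p q (pq : p <= q) z c :
  C p c -> sval z = pi p c -> sval (lift_mor pq z) = pi q c.
Proof. exact: morE. Qed.

Lemma lift_id p (pp : p <= p) :
  (forall x, lift_mor pp x = x) /\ (forall s, gh_semi (lift_mor pp) s = s).
Proof.
split=> [x|s]; last exact: (@sd_id _ _ S p pp s).
by have [c Cc cx] := svalP x; apply: sval_inj; rewrite (lift_morE _ Cc).
Qed.

(** All transition maps are induced by the identity of [B], so one representative in [C p] can be
    followed through both sides. *)
Lemma lift_comp p q r (pq : p <= q) (qr : q <= r) (pr : p <= r) :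
  (forall x, lift_mor pr x = lift_mor qr (lift_mor pq x)) /\
  (forall s, gh_semi (lift_mor pr) s = gh_semi (lift_mor qr) (gh_semi (lift_mor pq) s)).
Proof.
split=> [x|s]; last exact: (@sd_comp _ _ S p q r pq qr pr s).
have [c Cc cx] := svalP x; apply: sval_inj; rewrite (lift_morE pr Cc) //.
by rewrite (lift_morE qr (C_le pq Cc)) // (lift_morE pq Cc).
Qed.

Definition lift_diagram : gamp_diagram L P := GampDiagram lift_id lift_comp.

Lemma lift_partial_lifting : partial_lifting_of W lift_diagram S.
Proof.
have strong p q (pq : p <= q) : p < q -> gamp_hom_strong (lift_mor pq).
  by move=> pq'; apply: mor_strong; [apply: C_lt | apply: CsC].
split; last first.
  (* The semilattice of [lift_ob p] is [S p] itself, so identities form the natural isomorphism. *)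
  exists (fun p x => x); split=> [p|//]; split; first by split.
  by exists id.
split=> /=.
- by move=> p; apply: sub_gamp_of.
- by move=> p; apply: good_gamp_strong (goodC p).
- by move=> p; apply: good_congruence_tractable (goodC p).
- by move=> p; apply: good_distance_generated (goodC p).
- by move=> p; apply: sub_gamp_realization.
- exact: strong.
- move=> p q pq pq'; apply: mor_cuttable (goodC q) (C_F pq').
  exact: strong.
Qed.

End Assembly.

(** * Projections of the condensate *)

Section Projections.
Variables (L : signature) (d : Order.disp_t) (P : porderType d).
Variables (X : norm_covering P) (A : alg_diagram L P).

Definition sharp_at (u : set X) (p : P) : Prop := is_poset_ideal u /\ has_norm u p.

Lemma has_norm_inj (u : set X) p q : has_norm u p -> has_norm u q -> p = q.
Proof.
move=> [[x ux <-] hp] [[y uy <-] hq].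
by apply/le_anti; rewrite hp ?hq.
Qed.

Section Projection.
Variables (u : set X) (p : P) (h : sharp_at u p).

(** The finite set of elements of [V] in [u] has an upper bound in the directed set [u]; the floor
    in [V] of this bound is the required element. *)
Lemma ideal_floor_ex (V : kernel X) :
  exists v : V, u (val v) /\ forall w : V, u (val w) -> val w <= val v.
Proof.
have [[[x0 ux0] dir low] _] := h; have /asboolP[fV _] := kernelP V.
have [||x [_ ux]|[m um] hm] := @finite_directed _ {m | u m} (V `&` u)%classic
  (fun x m => x <= sval m) (finite_setIl _ fV).
- by split; exists x0.
- move=> [x ux] [y uy]; have [z [uz xz yz]] := dir _ _ ux uy.
  by exists (exist _ z uz) => t /= [] /le_trans; apply.
- by exists (exist _ x ux).
exists (kernel_floor V m); split; first exact: low (kernel_floor_le V m) um.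
move=> w uw; apply: kernel_floor_max; apply: hm; split=> //.
by apply: set_mem; case: (w).
Qed.

Definition ideal_floor (V : kernel X) : V := projT1 (cid (ideal_floor_ex V)).

Lemma ideal_floor_in V : u (val (ideal_floor V)).
Proof. by rewrite /ideal_floor; case: cid => v []. Qed.

Lemma ideal_floor_max (V : kernel X) (w : V) : u (val w) -> val w <= val (ideal_floor V).
Proof. by rewrite /ideal_floor; case: cid => v [] /= _; apply. Qed.

Lemma ideal_floor_norm V : nc_norm (val (ideal_floor V)) <= p.
Proof. by have [_ [_ hp]] := h; apply/hp/ideal_floor_in. Qed.

Lemma proj_at_hom (V : kernel X) l (x : 'I_(arity l) -> cond_ob A V) y :
  pa_graph (cond_ob A V) l x y ->
  pa_graph (A p) l ((fun a : cond_ob A V => ad_mor A (ideal_floor_norm V) (a (ideal_floor V))) \o x)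
    (ad_mor A (ideal_floor_norm V) (y (ideal_floor V))).
Proof. by move=> xy; apply: (pa_homP (ad_mor A (ideal_floor_norm V))) (xy _). Qed.

Definition proj_at (V : kernel X) : pa_hom (cond_ob A V) (A p) := 
  @PaHom _ (cond_ob A V) (A p) _ (@proj_at_hom V).

(** Taking the floor of [u] in [V'] and then its floor in [V] gives the floor of [u] in [V], so both
    sides read the same coordinate of [a]. *)
Lemma proj_at_mor (V V' : kernel X) (VV' : V <= V') (a : cond_ob A V) :
  proj_at V' (ad_mor (cond_diagram X A) VV' a) = proj_at V a.
Proof.
rewrite /= /cond_fun; set v' := ideal_floor V'.
have e : kernel_floor V (val v') = ideal_floor V.
  have [[_ _ low] _] := h.
  apply/val_inj/le_anti/andP; split.
    by apply/ideal_floor_max/(low _ _ (kernel_floor_le V _))/ideal_floor_in.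
  apply: kernel_floor_max.
  have V'f : (V' : set X) (val (ideal_floor V)).
    by apply/(kernel_leP V V').1 => //; apply: set_mem; case: (ideal_floor V).
  apply: (@ideal_floor_max V' (SigSub (mem_set V'f))); exact: ideal_floor_in.
have n : nc_norm (val (kernel_floor V (val v'))) <= p.
  by rewrite e; apply: ideal_floor_norm.
by rewrite -(ad_comp _ _ n); apply: cond_transport.
Qed.

Lemma proj_ex : exists f : pa_hom (condensate X A) (A p),
  forall V (a : cond_ob A V),
    f (dcolim_inj (cond_diagram X A) (kernels_directed X) V a) = proj_at V a.
Proof.
have [f [fE _]] := @dcolim_universal _ _ _ (cond_diagram X A)
  (kernels_directed X) (A p) proj_at proj_at_mor.
by exists f.
Qed.

Definition proj : pa_hom (condensate X A) (A p) := projT1 (cid proj_ex).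

Lemma projE V (a : cond_ob A V) :
  proj (dcolim_inj (cond_diagram X A) (kernels_directed X) V a) = proj_at V a.
Proof. by rewrite /proj; case: cid. Qed.

(** A kernel through an element of [u] of norm [p] has a floor of norm exactly [p], where [y] can be
    prescribed. *)
Lemma proj_surj (y : A p) : exists x, proj x = y.
Proof.
have [_ [[x ux xp] hp]] := h.
have [V [kV xV]] := nc_supported (finite_set1 x).
pose K := Kernel (introT (asboolP _) kV : `[< is_kernel V >]).
have def q : exists z : A q, True by have [z] := alg_inhabited (A q); exists z.
(* Coordinates whose norm is not above [p] receive arbitrary values; they exist because algebras are
   nonempty. *)
pose a : cond_ob A K := fun v => match @idP (p <= nc_norm (val v)) with
  | ReflectT pv => ad_mor A pv y | _ => projT1 (cid (def (nc_norm (val v)))) end.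
exists (dcolim_inj (cond_diagram X A) (kernels_directed X) K a).
rewrite projE /= /a; case: {-}_ / idP => [pv|[]].
  by rewrite -(ad_comp _ _ (lexx p)) ad_id.
have Kx : (K : set X) x by apply: xV.
rewrite -xp; apply: nc_isotone.
exact: (@ideal_floor_max K (SigSub (mem_set Kx)) ux).
Qed.

End Projection.

(* An element of the condensate supported by a kernel [V] cannot tell the ideal
   [v] from [u] if [V] does not meet [v] outside [u]. *)
Lemma proj_local (u v : set X) p q (hu : sharp_at u p) (hv : sharp_at v q)
    (pq : p <= q) (V : kernel X) : u `<=` v -> (V `&` v)%classic `<=` u ->
  forall a, proj_at hv V a = ad_mor A pq (proj_at hu V a).
Proof.
move=> uv Vvu a; have e : ideal_floor hv V = ideal_floor hu V.
  apply/val_inj/le_anti/andP; split; apply: ideal_floor_max.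
    apply: Vvu; split; last exact: ideal_floor_in.
    by apply: set_mem; case: (ideal_floor hv V).
  by apply: uv; apply: ideal_floor_in.
have n := le_trans (ideal_floor_norm hu V) pq.
have <- : ad_mor A n (a (ideal_floor hu V)) = ad_mor A pq (proj_at hu V a).
  exact: ad_comp (ideal_floor_norm hu V) pq n _.
exact: cond_transport (ideal_floor_norm hv V) n e.
Qed.

End Projections.

(** * Compact congruences of a directed colimit *)

Section CompactLevels.
Variables (L : signature) (d : Order.disp_t) (K : porderType d).
Variables (D : alg_diagram L K) (dK : directed K).

Definition at_level (th : conc (dcolim D dK)) (k : K) : Prop :=
  exists xi : conc (D k), th = conc_map (dcolim_inj D dK k) xi.

Lemma at_level_le th k m : k <= m -> at_level th k -> at_level th m.
Proof.
move=> km [xi ->]; exists (conc_map (ad_mor D km) xi).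
by apply: conc_map_comp => x; rewrite /= dcolim_in_mor.
Qed.

Lemma finite_at_level I (X : set I) (th : I -> conc (dcolim D dK)) :
  finite_set X -> (forall i, X i -> exists k, at_level (th i) k) ->
  exists k, forall i, X i -> at_level (th i) k.
Proof.
move=> fX; apply: finite_directed => //; first by case: dK.
move=> k k'; have [m [km k'm]] := dK.2 k k'; exists m => i [].
  exact: at_level_le.
exact: at_level_le.
Qed.

Lemma conc_at_level (th : conc (dcolim D dK)) : exists k, at_level th k.
Proof.
have [n [x [y ->]]] := conc_joins th.
have [|i _|k hk] := @finite_at_level 'I_n setT (fun i => Theta (x i) (y i)).
- exact: finite_finset.
- have [k [a ->]] := dcolim_in_surj (x i); have [k' [b ->]] := dcolim_in_surj (y i).
  have [m [km k'm]] := dK.2 k k'; exists m.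
  exists (Theta (ad_mor D km a) (ad_mor D k'm b)).
  by rewrite conc_map_Theta /= !dcolim_in_mor.
have [xi xiE] := choice (fun i => hk i I).
exists k, (\join_(i < n) xi i); rewrite (semihom_joins (conc_map_hom _)).
by apply: eq_bigr => i _; apply: xiE.
Qed.

End CompactLevels.

(** The number of predecessors drops strictly along [R]. It is counted within an enumeration of the
    predecessors of the fixed [x], which suffices by transitivity. *)
Lemma finite_pred_wf T (R : T -> T -> Prop) :
  (forall x, ~ R x x) -> (forall x y z, R x y -> R y z -> R x z) ->
  (forall x, finite_set [set y | R y x]) -> well_founded R.
Proof.
move=> Ri Rt Rf x; have [k [e eE]] := finite_enum (Rf x).
pose below y : {set 'I_k} := [set i | `[< R (e i) y >]]%SET.
have belowP i y : i \in below y <-> R (e i) y.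
  by rewrite finset.in_set; split=> /asboolP.
suff H n y : R y x -> (#|below y| < n)%N -> Acc R y.
  by split=> y yx; apply: (H #|below y|.+1).
elim: n y => [|n IH] y yx; first by rewrite ltn0.
move=> yn; split=> z zy; apply: IH; first exact: Rt zy yx.
rewrite -ltnS; apply: leq_trans yn; rewrite ltnS; apply: proper_card; apply/properP; split.
  by apply/fintype.subsetP => i /belowP iz; apply/belowP; apply: Rt iz zy.
have [i _ iz] : (e @` setT) z by rewrite -eE; apply: Rt zy yx.
exists i; first by apply/belowP; rewrite iz.
by apply/negP => /belowP; rewrite iz; apply: Ri.
Qed.

(** * The partial lifting *)

Section LiftingData.
Variables (LV LW : signature) (LW_finite : finite_set [set: symbol LW]).
Variables (d : Order.disp_t) (P : porderType d).
Variables (X : norm_covering P) (XX : set (set X)) (X_lifter : aleph0_lifter XX).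
Variables (A : alg_diagram LV P).
Hypothesis A_finite : forall p, ~ maximal p -> finite_set [set: conc (A p)].
Variables (B : algebra LW) (chi : conc B -> conc (condensate X A)).
Hypotheses (chih : is_semihom chi) (chib : bijective chi).

Definition norm_map (u : set X) p (h : sharp_at u p) : conc B -> conc (A p) :=
  conc_map (proj A h) \o chi.

Lemma norm_map_quotient u p (h : sharp_at u p) : quotient_map (norm_map h).
Proof.
apply: quotient_map_comp_iso => //; apply: conc_map_quotient_map; exact: proj_surj.
Qed.

Definition norm_proj u p (h : sharp_at u p) :
    pa_hom B (quot_alg (ker_ideal (norm_map_quotient h))) :=
  quot_proj (ker_ideal (norm_map_quotient h)).

(* The norm [p] of [u] is unique, but determines the type of the target [conc (A p)]. *)
Definition good_at (u : set X) (F Cs C : set B) : Prop :=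
  forall p (h : sharp_at u p),
    good (rq := norm_map_quotient h) (norm_proj h @` F) (norm_proj h @` Cs)
      (norm_proj h @` C).

(** The sets found in the quotient are lifted to [B] by a section [r]. Adding [F] gives the
    inclusions in [B] itself and leaves the images unchanged. *)
Lemma good_at_exists u F : nonmax_part XX u -> finite_set F ->
  exists Cs C, [/\ finite_set C, F `<=` Cs, Cs `<=` C & good_at u F Cs C].
Proof.
move=> [XXu [p up pmax]] fF; have [uid _] := lifter_sharp X_lifter XXu.
have h : sharp_at u p by split.
pose pi := norm_proj h.
have [Gs [G [fGs fG FG]]] := good_exists LW_finite
  (A_finite pmax) (finite_image pi fF).
have [r rK] := choice (@quot_proj_surj _ _ (ker_ideal (norm_map_quotient h))).
exists (F `|` r @` Gs)%classic, (F `|` r @` G)%classic; split.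
- by rewrite finite_setU; split=> //; apply: finite_image.
- by move=> x; left.
- by move=> x [Fx|[y Gy <-]]; [left | right; exists y => //; apply: (good_sub FG)].
move=> q hq; have qp : q = p by apply: has_norm_inj up; case: hq.
subst q; rewrite (Prop_irrelevance hq h) !image_setU.
have rE (H : set (quot_alg (ker_ideal (norm_map_quotient h)))) : pi @` (r @` H) = H.
  rewrite image_comp; apply/seteqP; split=> [_ [y Hy <-]|y Hy]; last first.
    by exists y => //; apply: rK.
  by rewrite (_ : (pi \o r) y = y) //; apply: rK.
have FGs := good_F FG; have FG' := subset_trans FGs (good_sub FG).
by rewrite !rE (setUidr FGs) (setUidr FG').
Qed.

Definition below (v u : set X) : Prop :=
  [/\ nonmax_part XX v, nonmax_part XX u, v `<=` u & v <> u].

Lemma below_finite u : finite_set [set v | below v u].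
Proof.
have [nu|nu] := pselect (nonmax_part XX u).
  apply: sub_finite_set (lifter_finite X_lifter nu).
  by move=> v [[XXv _] _ vu _].
by apply: sub_finite_set (finite_set0 _) => v [].
Qed.

Lemma below_wf : well_founded below.
Proof.
apply: finite_pred_wf => [u [_ _ _]|u v w [nu nv uv uNv] [_ nw vw vNw]|u] //.
  split=> // [|uw]; first exact: subset_trans uv vw.
  by apply: vNw; apply/seteqP; split=> //; rewrite -uw.
exact: below_finite.
Qed.

Lemma good_family : exists F Cs C : set X -> set B, forall u, nonmax_part XX u ->
  [/\ finite_set (C u), F u `<=` Cs u, Cs u `<=` C u, good_at u (F u) (Cs u) (C u)
    & forall v, below v u -> with_values (C v) `<=` F u].
Proof.
(* The choice has to be total for the recursion, since finiteness of [F u] is known only by the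
   later induction; the empty default is harmless. *)
have step (uF : set X * set B) : exists CC : set B * set B,
    nonmax_part XX uF.1 -> finite_set uF.2 ->
    [/\ finite_set CC.2, uF.2 `<=` CC.1, CC.1 `<=` CC.2
      & good_at uF.1 uF.2 CC.1 CC.2].
  have [h|h] := pselect (nonmax_part XX uF.1 /\ finite_set uF.2).
    by have [Cs [C hC]] := good_at_exists h.1 h.2; exists (Cs, C).
  by exists (set0, set0) => nu fF; case: h.
have [E hE] := choice step.
pose FF (u : set X) (rec : forall v, below v u -> set B * set B) : set B :=
  [set b | exists v (vu : below v u), with_values (rec v vu).2 b].
pose CC := Fix below_wf (fun _ => (set B * set B)%type) (fun u rec => E (u, FF u rec)).
pose F u := FF u (fun v _ => CC v).
have CCE u : CC u = E (u, F u).
  rewrite /CC Fix_eq // => v f g fg; congr (E (_, FF _ _)).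
  by apply: functional_extensionality_dep => w; apply/funext.
exists F, (fun u => (CC u).1), (fun u => (CC u).2) => u.
elim/(well_founded_ind below_wf): u => u IH nu.
have fF : finite_set (F u).
  have fvs : forall v, [set v | below v u] v -> finite_set (with_values (CC v).2).
    move=> v vu; apply: with_values_finite => //.
    by have [] := IH v vu; first by case: vu.
  apply: sub_finite_set (bigcup_finite (below_finite u) fvs).
  by move=> b [v [vu hb]]; exists v.
have [] := hE (u, F u) nu fF; rewrite -CCE /= => fC FCs CsC gC; split=> //.
by move=> v vu b hb; exists v, vu.
Qed.

End LiftingData.

Theorem theorem9p3 (LV LW : signature)
  (V : algebra LV -> Prop) (W : algebra LW -> Prop)
  (V_variety : is_variety V) (W_variety : is_variety W)
  (LW_finite : finite_set [set: symbol LW])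
  (d : Order.disp_t) (P : porderType d)
  (X : norm_covering P) (XX : set (set X)) (X_lifter : aleph0_lifter XX)
  (A : alg_diagram LV P) (A_in_V : forall p, V (A p))
  (A_finite : forall p, ~ maximal p -> finite_set [set: conc (A p)])
  (B : algebra LW) (B_in_W : W B)
  (B_iso : semi_isomorphic (conc B) (conc (condensate X A))) :
  exists BB : gamp_diagram LW P,
    [/\ partial_lifting_of W BB (conc_diagram A),
        forall p, ~ maximal p -> gamp_finite (BB p)
      & forall p, maximal p ->
          exists I : ideal (pg_semi (gamp_of_alg B)),
            gamp_isomorphic (BB p) (gamp_quot I)].
Proof.
have [chi [chih chib]] := B_iso.
have [F0 [Cs0 [C0 hC]]] := good_family LW_finite X_lifter A_finite chih chib.
(* For [u] of nonmaximal norm finitely many principal congruences are concerned; elsewhere any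
   kernel serves. *)
have level u : exists K : kernel X, nonmax_part XX u ->
    forall a b, with_values (C0 u) a -> with_values (C0 u) b ->
      at_level (chi (Theta a b)) K.
  have [nu|nu] := pselect (nonmax_part XX u); last first.
    by have [[K] _] := kernels_directed X; exists K.
  have [fC _ _ _ _] := hC u nu.
  have fCC := with_values_finite LW_finite fC.
  have [|K hK] := finite_at_level (th := fun z : B * B => chi (Theta z.1 z.2))
    (finite_setX fCC fCC).
    by move=> z _; apply: conc_at_level.
  by exists K => _ a b Ca Cb; apply: (hK (a, b)).
have [K hK] := choice level.
have [|sigma [XXs s_le s_norm s_sep]] :=
    lifter_section X_lifter (S := fun u => K u : set X).
  by move=> u _; have /asboolP[] := kernelP (K u).
have sh p : sharp_at (sigma p) p.
  by split=> //; have [] := lifter_sharp X_lifter (XXs p).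
have nonmax p : ~ maximal p -> nonmax_part XX (sigma p).
  by move=> pm; split=> //; exists p.
have lt_nonmax (p q : P) : p < q -> ~ maximal p.
  by move=> pq pm; have := pm q (ltW pq); move=> qp; rewrite qp ltxx in pq.
have lt_below p q : p < q -> ~ maximal q -> below XX (sigma p) (sigma q).
  move=> pq qm; split; [exact/nonmax/lt_nonmax/pq | exact: nonmax | exact/s_le/ltW |].
  move=> e; have pq' : p = q by apply: has_norm_inj (s_norm q); rewrite -e.
  by rewrite pq' ltxx in pq.
(* Taking all of [B] at maximal [p] makes the gamp there the full quotient. *)
pose ext (D : set X -> set B) p := if pselect (maximal p) then setT else D (sigma p).
have extT D p : maximal p -> ext D p = setT by rewrite /ext; case: pselect.
have extN D p : ~ maximal p -> ext D p = D (sigma p) by rewrite /ext; case: pselect.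
pose rq p := norm_map_quotient chih chib (sh p).
have piT p : quot_proj (ker_ideal (rq p)) @` setT = setT.
  apply/seteqP; split=> // z _; have [b bz] := quot_proj_surj z.
  by exists b.
have goodC p : good (quot_proj (ker_ideal (rq p)) @` ext F0 p)
    (quot_proj (ker_ideal (rq p)) @` ext Cs0 p) (quot_proj (ker_ideal (rq p)) @` ext C0 p).
  have [pm|pm] := pselect (maximal p); first by rewrite !extT // piT; apply: good_setT.
  rewrite !extN //; have [_ _ _ g _] := hC _ (nonmax p pm); exact: g.
have CsC p : ext Cs0 p `<=` ext C0 p.
  have [pm|pm] := pselect (maximal p); first by rewrite !extT.
  by rewrite !extN //; have [] := hC _ (nonmax p pm).
have FCs p : ext F0 p `<=` ext Cs0 p.
  have [pm|pm] := pselect (maximal p); first by rewrite !extT.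
  by rewrite !extN //; have [] := hC _ (nonmax p pm).
have C_lt p q : p < q -> with_values (ext C0 p) `<=` ext F0 q.
  move=> pq; have [qm|qm] := pselect (maximal q); first by rewrite (extT F0).
  rewrite (extN F0) // (extN C0); last exact: lt_nonmax pq.
  have [_ _ _ _] := hC _ (nonmax q qm); apply; exact: lt_below.
have C_F p q : p < q -> ext C0 p `<=` ext F0 q.
  by move=> pq x Cx; apply: C_lt pq _ _; left.
have C_le p q : p <= q -> ext C0 p `<=` ext C0 q.
  rewrite le_eqVlt => /orP[/eqP->//|pq] x Cx; apply/CsC/FCs; exact: C_F pq _ Cx.
have Cs_le p q : p <= q -> ext Cs0 p `<=` ext Cs0 q.
  rewrite le_eqVlt => /orP[/eqP->//|pq] x /CsC Cx; apply/FCs; exact: C_F pq _ Cx.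
have compat p q (pq : p <= q) a b :
    with_values (ext C0 p) a -> with_values (ext C0 p) b ->
    norm_map chi (sh q) (Theta a b) =
      sd_mor (s := conc_diagram A) pq (norm_map chi (sh p) (Theta a b)).
  have [e|pNq] := eqVneq p q.
    by subst q => _ _; apply: esym (@sd_id _ _ (conc_diagram A) p pq _).
  have ltpq : p < q by rewrite lt_neqAle pNq.
  have pm := lt_nonmax _ _ ltpq; rewrite !extN // => Ca Cb.
  have [xi xiE] := hK _ (nonmax p pm) a b Ca Cb.
  rewrite /norm_map /= xiE.
  (* The congruence comes from level [K (sigma p)], which by [s_sep] meets [sigma q] only inside
     [sigma p]; at this level the projection for [q] factors through that for [p]. *)
  have H : forall x, proj_at A (sh q) (K (sigma p)) x =
      ad_mor A pq (proj_at A (sh p) (K (sigma p)) x).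
    by apply: proj_local; [apply: s_le | apply: s_sep].
  pose inj := dcolim_inj (cond_diagram X A) (kernels_directed X) (K (sigma p)).
  have qE := @conc_map_comp _ _ _ _ inj (proj A (sh q)) (proj_at A (sh q) (K (sigma p)))
    (fun x => esym (projE _ _)) xi.
  have pE := @conc_map_comp _ _ _ _ inj (proj A (sh p)) (proj_at A (sh p) (K (sigma p)))
    (fun x => esym (projE _ _)) xi.
  by rewrite -qE -pE; apply: conc_map_comp.
have C_lt' p q : p < q -> with_values (ext C0 p) `<=` ext Cs0 q.
  by move=> pq x /(C_lt _ _ pq); apply: FCs.
exists (lift_diagram (S := conc_diagram A) rq CsC C_le Cs_le compat); split.
- exact: (lift_partial_lifting (S := conc_diagram A) W_variety B_in_W goodC _ _ _ C_lt' C_F).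
- move=> p pm; split; last exact: A_finite.
  apply: finite_sig; apply: finite_image; rewrite extN //.
  by have [] := hC _ (nonmax p pm).
- move=> p pm; exists (ker_ideal (rq p)); apply: full_sub_gamp_quot => z.
    by rewrite extT // piT.
  by rewrite extT // piT.
Qed.
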